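(* Suppose $R$ is a local Cohen-Macaulay ring of bounded multiplicity type. Then there exist an $R$-algebra $Z$ and a complex of finite free $Z$-modules $\mathcal F_\bullet$ such that for every indecomposable maximal Cohen-Macaulay $R$-module $M$ there exists a section $Z\to R$ such that $\mathcal F_\bullet\otimes_ZR$ is a free resolution of $M$.
   Context: Local Cohen-Macaulay rings are Noetherian. $R$ is of bounded multiplicity type if there is a bound on the multiplicities of all of its indecomposable maximal Cohen-Macaulay modules. A section $Z\to R$ of an $R$-algebra $Z$ is an $R$-algebra homomorphism. *)

(* Defs.v *)
From mathcomp Require Export all_boot all_order all_algebra ring_quotient.
From mathcomp Require Export boolp classical_sets.

Set Implicit Arguments.
Unset Strict Implicit.
Unset Printing Implicit Defensive.

Import GRing.Theory.
Local Open Scope classical_set_scope.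
Local Open Scope ring_scope.

(* Dimensions, depths, lengths and multiplicities are all rendered as relations
   "the invariant is defined and equals n". *)
Definition is_max (P : nat -> Prop) (n : nat) : Prop :=
  P n /\ forall k, P k -> (k <= n)%N.

(* A chain C 0 < ... < C k; the values of C beyond k are irrelevant. *)
Definition has_chain (T : Type) (P : set (set T)) (k : nat) : Prop :=
  exists C : nat -> set T,
    (forall i, (i <= k)%N -> P (C i)) /\
    (forall i, (i < k)%N -> C i `<` C i.+1).

Section Modules.
Variables (R : comNzRingType) (M : lmodType R).
Implicit Types (N L : set M) (I : set R).

Definition submodule N : Prop := GRing.submod_closed [in N].

Definition span (xs : seq M) : set M :=
  [set y | exists a : 'I_(size xs) -> R, y = \sum_(i < size xs) a i *: xs`_i].

Definition finitely_generated : Prop := exists xs : seq M, span xs = setT.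

Definition ideal_smul I N : set M :=
  [set y | exists s : seq (R * M),
     (forall p, p \in s -> I p.1 /\ N p.2) /\ y = \sum_(p <- s) p.1 *: p.2].

(* I^n M, as I (I (... (I M))). *)
Definition ideal_pow_smul I (n : nat) : set M := iter n (ideal_smul I) setT.

(* The length of M / N: submodules of M / N are the submodules of M
   containing N. *)
Definition quotient_length N (l : nat) : Prop :=
  is_max (has_chain [set L | submodule L /\ N `<=` L]) l.

Definition annihilator : set R := [set a | forall x : M, a *: x = 0].

Definition indecomposable : Prop :=
  (exists x : M, x != 0) /\
  forall N L, submodule N -> submodule L ->
    N `&` L = [set 0] ->
    (forall z, exists x y, [/\ N x, L y & z = x + y]) ->
    N = [set 0] \/ L = [set 0].

End Modules.

Section Rings.
Variable R : comNzRingType.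
Implicit Types (I m p : set R).

Definition noetherian : Prop :=
  forall I : set R^o, submodule I -> exists xs : seq R^o, span xs = I.

(* [idealr_closed] includes properness. *)
Definition maximal_ideal m : Prop :=
  idealr_closed [in m] /\
  forall I, idealr_closed [in I] -> m `<=` I -> I = m.

Definition prime_ideal p : Prop :=
  idealr_closed [in p] /\ prime_idealr_closed [in p].

Definition local_ring m : Prop :=
  maximal_ideal m /\ forall I, maximal_ideal I -> I = m.

(* The Krull dimension of R / I. *)
Definition quotient_dim I (d : nat) : Prop :=
  is_max (has_chain [set p | prime_ideal p /\ I `<=` p]) d.

Definition ring_dim (d : nat) : Prop := quotient_dim [set 0] d.

End Rings.

Section CohenMacaulay.
Variables (R : comNzRingType) (m : set R).
Implicit Type M : lmodType R.

Definition module_dim M (d : nat) : Prop := quotient_dim (annihilator M) d.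

Definition regular_sequence M (xs : seq R) : Prop :=
  (forall i, (i < size xs)%N -> forall z : M,
     let N := ideal_smul (span (take i xs : seq R^o)) [set: M] in
     N (xs`_i *: z) -> N z) /\
  ideal_smul (span (xs : seq R^o)) [set: M] <> setT.

(* No n qualifies for M = 0, whose depth is infinite by convention. *)
Definition depth M (n : nat) : Prop :=
  is_max (fun k => exists xs : seq R,
    [/\ size xs = k, forall x, x \in xs -> m x & regular_sequence M xs]) n.

Definition maximal_CM M : Prop :=
  finitely_generated M /\ exists2 d, ring_dim R d & depth M d.

Definition local_CM_ring : Prop :=
  [/\ noetherian R, local_ring m & maximal_CM R^o].

(* P is the Hilbert-Samuel polynomial of M, and e is d! times its coefficient
   in degree d = dim M. *)
Definition multiplicity M (e : nat) : Prop :=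
  exists (d : nat) (P : {poly rat}),
    [/\ module_dim M d,
        exists n0, forall n, (n0 <= n)%N ->
          exists2 l, quotient_length (ideal_pow_smul m n : set M) l
                   & P.[n%:R] = l%:R
      & e%:R = d`!%:R * P`_d].

Definition bounded_multiplicity_type : Prop :=
  exists B : nat, forall M : lmodType R,
    maximal_CM M -> indecomposable M ->
    exists2 e, multiplicity M e & (e <= B)%N.

End CohenMacaulay.

(* ... -> Z^(rank 2) -> Z^(rank 1) -> Z^(rank 0), where the differentials act
   on row vectors by v |-> v *m differential i. *)
Record free_complex (Z : comNzRingType) := FreeComplex {
  rank : nat -> nat;
  differential : forall i, 'M[Z]_(rank i.+1, rank i);
  differentialK : forall i, differential i.+1 *m differential i = 0 }.

Lemma base_change_differentialK (R : comNzRingType) (Z : comAlgType R)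
    (s : {lrmorphism Z -> R^o}) (F : free_complex Z) (i : nat) :
  (map_mx s (differential F i.+1) : 'M[R]_(_, _)) *m
  (map_mx s (differential F i) : 'M[R]_(_, _)) = 0.
Proof.
by have := congr1 (map_mx s) (differentialK F i); rewrite map_mxM map_mx0.
Qed.

(* F (x)_Z R along the R-algebra homomorphism (section) s, under the
   identification of Z^n (x)_Z R with R^n. *)
Definition base_change (R : comNzRingType) (Z : comAlgType R)
    (s : {lrmorphism Z -> R^o}) (F : free_complex Z) : free_complex R :=
  FreeComplex (base_change_differentialK s F).

Definition free_resolution (R : comNzRingType) (F : free_complex R)
    (M : lmodType R) : Prop :=
  exists eps : {linear 'rV[R]_(rank F 0) -> M},
    [/\ forall y : M, exists v, eps v = y,
        forall v, eps v = 0 <-> exists w, v = w *m differential F 0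
      & forall i (v : 'rV[R]_(rank F i.+1)),
          v *m differential F i = 0 <-> exists w, v = w *m differential F i.+1].

(* Main.v *)
Require Import Defs.
From HB Require Import structures.
From mathcomp Require Import ring lra zify.
Set Implicit Arguments.
Unset Strict Implicit.
Unset Printing Implicit Defensive.
Import Order.TTheory GRing.Theory Num.Theory.
Local Open Scope classical_set_scope.
Local Open Scope ring_scope.

(** A complex of free [R]-modules of ranks [b 0, b 1, ...] is a point of the set [I]
    of sequences of matrices with vanishing consecutive products; over the algebra
    of all functions [I -> R] there is a tautological complex, and evaluating it at
    a point of [I] recovers that point.  It therefore suffices to bound
    the ranks in some free resolution of each indecomposable maximal Cohen-Macaulay
    module [M] uniformly in [M].

    Fix an [R]-regular sequence [x] of length [d = dim R].  Only the maximal ideal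
    [m] is a prime containing [x], so [m^k] lies in [(x)] for some [k].  If [M] has a
    regular sequence of length [d] in [m], then the Koszul homology [H_j(x; M)]
    vanishes for [j > 0], and [x] is [M]-regular by Nakayama; the same holds for
    the powers [x_i^n].  Hence [n^d l(M / xM) = l(M / (x_i^n) M)], which is at most
    [l(M / m^(Kn) M)] with [K = k(d+1)], and comparing the growth in [n] gives
    [l(M / xM) <= K^d e(M)].  A bound [l(M / xM) <= c] gives a surjection
    [R^c -> M]; as [x] is regular on [R] and [M], it is regular on the kernel [N],
    and [N / xN] embeds in [(R / x)^c], so [l(N / xN) <= c l(R / x)], and one
    iterates. *)

(** * Submodules *)

Section Submodules.
Variables (R : comNzRingType) (M : lmodType R).
Implicit Types (N A B L : set M) (xs : seq R) (us : seq M).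

Lemma submoduleP N :
  submodule N <-> N 0 /\ forall a u v, N u -> N v -> N (a *: u + v).
Proof.
split=> -[N0 Nlin]; split.
- by move: N0; rewrite inE.
- by move=> a u v Nu Nv; have := Nlin a u v; rewrite !inE; apply.
- by rewrite inE.
- by move=> a u v; rewrite !inE; apply: Nlin.
Qed.

Lemma submod0 N : submodule N -> N 0.
Proof. by case/submoduleP. Qed.

Lemma submodZD N a u v : submodule N -> N u -> N v -> N (a *: u + v).
Proof. by case/submoduleP=> _; apply. Qed.

Lemma submodZ N a u : submodule N -> N u -> N (a *: u).
Proof. by move=> sN Nu; rewrite -[_ *: _]addr0; apply: submodZD => //; apply: submod0. Qed.

Lemma submodD N u v : submodule N -> N u -> N v -> N (u + v).
Proof. by move=> sN Nu Nv; rewrite -[u]scale1r; apply: submodZD. Qed.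

Lemma submodN N u : submodule N -> N u -> N (- u).
Proof. by move=> sN Nu; rewrite -scaleN1r; apply: submodZ. Qed.

Lemma submodB N u v : submodule N -> N u -> N v -> N (u - v).
Proof. by move=> sN Nu Nv; apply: submodD => //; apply: submodN. Qed.

Lemma submod_sum N (I : eqType) (r : seq I) (F : I -> M) : submodule N ->
  (forall i, i \in r -> N (F i)) -> N (\sum_(i <- r) F i).
Proof.
move=> sN; elim: r => [|i r IHr] NF; first by rewrite big_nil; apply: submod0.
rewrite big_cons; apply: submodD => //; first by apply: NF; rewrite mem_head.
by apply: IHr => j rj; apply: NF; rewrite inE rj orbT.
Qed.

Lemma submodT : submodule [set: M]. Proof. by apply/submoduleP. Qed.

Lemma submod_zero : submodule [set 0 : M].
Proof.
by apply/submoduleP; split=> // a u v /= -> ->; rewrite scaler0 addr0.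
Qed.

Lemma submodI N L : submodule N -> submodule L -> submodule (N `&` L).
Proof.
move=> sN sL; apply/submoduleP; split; first by split; apply: submod0.
by move=> a u v [Nu Lu] [Nv Lv]; split; apply: submodZD.
Qed.

Definition add_submod N L : set M :=
  [set u | exists v w, [/\ N v, L w & u = v + w]].

(** The submodule [N] + [x] [A]. Here [A] is a subset of [M] and not a type, so that syzygies, which
    arise as kernels, are handled where they stand. *)
Definition adjoin N (x : R) A : set M :=
  [set u | exists v w, [/\ N v, A w & u = v + x *: w]].

Lemma submod_add N L : submodule N -> submodule L -> submodule (add_submod N L).
Proof.
move=> sN sL; apply/submoduleP; split.
  by exists 0, 0; rewrite addr0; split=> //; apply: submod0.
move=> a _ _ [v [w [Nv Lw ->]]] [v' [w' [Nv' Lw' ->]]].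
exists (a *: v + v'), (a *: w + w'); split; [exact: submodZD..|].
by rewrite scalerDr addrACA.
Qed.

Lemma submod_adjoin N x A :
  submodule N -> submodule A -> submodule (adjoin N x A).
Proof.
move=> sN sA; apply/submoduleP; split.
  by exists 0, 0; rewrite scaler0 addr0; split=> //; apply: submod0.
move=> a _ _ [v [w [Nv Aw ->]]] [v' [w' [Nv' Aw' ->]]].
exists (a *: v + v'), (a *: w + w'); split; [exact: submodZD..|].
by rewrite !scalerDr !scalerA [a * x]mulrC addrACA.
Qed.

Lemma sub_adjoin N x A : submodule A -> N `<=` adjoin N x A.
Proof. by move=> /submod0 A0 u Nu; exists u, 0; rewrite scaler0 addr0. Qed.

Lemma adjoin_scale N x A u : submodule N -> A u -> adjoin N x A (x *: u).
Proof. by move=> /submod0 N0 Au; exists 0, u; rewrite add0r. Qed.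

Lemma adjoin_sub N x A L : submodule L -> N `<=` L ->
  (forall u, A u -> L (x *: u)) -> adjoin N x A `<=` L.
Proof.
by move=> sL NL AL _ [v [w [/NL Lv /AL Lw ->]]]; apply: submodD.
Qed.

Definition adjoin_seq A N xs : set M := foldl (fun L x => adjoin L x A) N xs.

Lemma submod_adjoin_seq A N xs :
  submodule A -> submodule N -> submodule (adjoin_seq A N xs).
Proof. by move=> sA; elim: xs N => //= x xs IHxs N sN; apply/IHxs/submod_adjoin. Qed.

Lemma sub_adjoin_seq A N xs : submodule A -> N `<=` adjoin_seq A N xs.
Proof.
move=> sA; elim: xs N => [N|x xs IHxs N]; first exact: subset_refl.
exact: subset_trans (sub_adjoin _ sA) (IHxs _).
Qed.

Lemma adjoin_seq_scale A N xs x u : submodule A -> submodule N ->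
  x \in xs -> A u -> adjoin_seq A N xs (x *: u).
Proof.
move=> sA; elim: xs N => //= y xs IHxs N sN; rewrite inE => /orP[/eqP ->|xs_x] Au.
  by apply: sub_adjoin_seq => //; apply: adjoin_scale.
by apply: IHxs => //; apply: submod_adjoin.
Qed.

Lemma adjoin_seq_sub A N L xs : submodule L -> N `<=` L ->
  (forall x u, x \in xs -> A u -> L (x *: u)) -> adjoin_seq A N xs `<=` L.
Proof.
move=> sL; elim: xs N => [N NL _|x xs IHxs N NL AL]; first exact: NL.
apply: IHxs => [|y u xs_y].
  by apply: adjoin_sub => // u; apply: AL; rewrite mem_head.
by apply: AL; rewrite inE xs_y orbT.
Qed.

Lemma adjoin_seq_rcons A N xs x :
  adjoin_seq A N (rcons xs x) = adjoin (adjoin_seq A N xs) x A.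
Proof. by rewrite /adjoin_seq -cats1 foldl_cat. Qed.

(** Both sides are the smallest submodule containing [N] and all products [x] [A]. This allows an
    entry to be moved to the end of a sequence. *)
Lemma eq_mem_adjoin_seq A N xs ys : submodule A -> submodule N ->
  xs =i ys -> adjoin_seq A N xs = adjoin_seq A N ys.
Proof.
move=> sA sN eqxy; apply/seteqP; split; apply: adjoin_seq_sub => [||x u xs_x Au];
  try exact: submod_adjoin_seq; try exact: sub_adjoin_seq.
  by apply: adjoin_seq_scale; rewrite -?eqxy.
by apply: adjoin_seq_scale; rewrite ?eqxy.
Qed.

Lemma submod_span us : submodule (span us).
Proof.
apply/submoduleP; split.
  by exists (fun=> 0); rewrite big1 // => i _; rewrite scale0r.
move=> a _ _ [b ->] [c ->]; exists (fun i => a * b i + c i).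
rewrite scaler_sumr -big_split; apply: eq_bigr => i _.
by rewrite scalerDl scalerA.
Qed.

Lemma span_nil : span [::] = [set 0 : M].
Proof.
apply/seteqP; split=> u; first by case=> a ->; rewrite big_ord0.
by move=> ->; exists (fun=> 0); rewrite big_ord0.
Qed.

Lemma span_cons v us w : span (v :: us) w <->
  exists a u, span us u /\ w = a *: v + u.
Proof.
split=> [[a ->]|[a [_ [[b ->] ->]]]].
  rewrite big_ord_recl; exists (a ord0), (\sum_(i < size us) a (lift ord0 i) *: us`_i).
  by split=> //; exists (fun i => a (lift ord0 i)).
exists (fun i => oapp b a (unlift ord0 i)); rewrite big_ord_recl unlift_none.
by congr (_ + _); apply: eq_bigr => i _; rewrite liftK.
Qed.

Lemma span_sub us N : submodule N -> (forall u, u \in us -> N u) -> span us `<=` N.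
Proof.
move=> sN Nus _ [a ->]; apply: submod_sum => // i _.
by apply: submodZ => //; apply/Nus/mem_nth.
Qed.

Lemma mem_span us u : u \in us -> span us u.
Proof.
elim: us => //= v us IHus; rewrite inE => /orP[/eqP ->|/IHus us_u].
  apply/span_cons; exists 1, 0; rewrite scale1r addr0; split=> //.
  by apply: submod0; apply: submod_span.
by apply/span_cons; exists 0, u; rewrite scale0r add0r.
Qed.

Lemma span_subset us vs : {subset us <= vs} -> span us `<=` span vs.
Proof.
move=> sub; apply: span_sub; first exact: submod_span.
by move=> u /sub; apply: mem_span.
Qed.

End Submodules.

(** * Finite generation of submodules, and Nakayama's lemma *)

Section FinitelyGenerated.
Variables (R : comNzRingType) (M : lmodType R).
Implicit Types (N B : set M) (us : seq M).

(** Induction on [us]: the coefficients of the first generator in elements of [N] form an ideal;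
    lifts of its generators, together with generators of the part of [N] in the remaining span,
    generate [N]. *)
Lemma noetherian_span us N : noetherian R -> submodule N -> N `<=` span us ->
  exists vs, span vs = N.
Proof.
move=> noethR; elim: us N => [|u us IHus] N sN Nus.
  exists [::]; rewrite span_nil; apply/seteqP; split=> [_ ->|w /Nus].
    exact: submod0.
  by rewrite span_nil.
pose I : set R^o := [set a | exists2 v, span us v & N (a *: u + v)].
have sspan := submod_span us.
have sI : submodule I.
  apply/submoduleP; split.
    by exists 0; [exact: submod0 | rewrite scale0r addr0; apply: submod0].
  move=> a b c [v us_v Nv] [w us_w Nw]; exists (a *: v + w); first exact: submodZD.
  by rewrite scalerDl -scalerA addrACA -scalerDr; apply: submodZD.
have [cs spanI] := noethR I sI.
have [vs' spanN'] : exists vs', span vs' = N `&` span us.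
  by apply: IHus => [|w []] //; apply: submodI.
(* Lifts to [N] of the generators of [I]: modulo [span us], each [a *: u] with [a] in [I] is a
   combination of them. *)
have [vs [Nvs vsI]] : exists vs, (forall v, v \in vs -> N v) /\
    forall a, span cs a -> exists2 v, span vs v & span us (a *: u - v).
  have : forall c, c \in cs -> I c by move=> c /mem_span; rewrite spanI.
  elim: cs {spanI} => [|c cs IHcs] Ics.
    exists [::]; split=> // a; rewrite span_nil => ->; exists 0.
      by rewrite span_nil.
    by rewrite scale0r subr0; apply: submod0.
  have [|vs [Nvs vsP]] := IHcs; first by move=> b cs_b; apply: Ics; rewrite inE cs_b orbT.
  have [v us_v Nv] := Ics c (mem_head _ _).
  exists ((c *: u + v) :: vs); split.
    by move=> w; rewrite inE => /orP[/eqP->|/Nvs].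
  move=> a /span_cons[b [a' [/vsP[w vs_w us_w] ->]]].
  exists (b *: (c *: u + v) + w); first by apply/span_cons; exists b, w.
  rewrite -[b *: c]/(b * c) scalerDl -scalerA scalerDr opprD addrACA opprD.
  rewrite [X in X + _]addrA addrN add0r.
  by apply: submodD => //; apply: submodN => //; apply: submodZ.
exists (vs ++ vs'); apply/seteqP; split.
  apply: span_sub => // w; rewrite mem_cat => /orP[/Nvs //|/mem_span].
  by rewrite spanN' => -[].
move=> w Nw; have /span_cons[a [v [us_v def_w]]] := Nus w Nw.
have [|z vs_z us_z] := vsI a; first by rewrite spanI; exists v; rewrite -?def_w.
have Nz : N z by move: vs_z; apply: span_sub.
have : span vs' (w - z).
  rewrite spanN'; split; first exact: submodB.
  by rewrite def_w addrAC; apply: submodD.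
move=> /(span_subset (us := vs') (vs := vs ++ vs')) wz.
have {}wz := wz (fun x hx => ltac:(by rewrite mem_cat hx orbT)).
rewrite -[w](subrK z); apply: submodD wz _; first exact: submod_span.
by apply: span_subset vs_z => x hx; rewrite mem_cat hx.
Qed.

Lemma fg_noetherian N : noetherian R -> finitely_generated M ->
  submodule N -> exists us, span us = N.
Proof.
by move=> noethR [us spanM] sN; apply: (noetherian_span (us := us)) => //; rewrite spanM.
Qed.

(** The first hypothesis puts [x] in the Jacobson radical. In the relation for the first generator
    its coefficient 1 - [x] [a] is a unit; solving for that generator and substituting in the other
    relations removes it. *)
Lemma nakayama (x : R) us B : (forall a, exists c, c * (1 - x * a) = 1) ->
    submodule B -> (forall u, u \in us -> adjoin B x (span us) u) ->
  span us `<=` B.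
Proof.
move=> radx sB; elim: us => [|n us IHus] Bus.
  by rewrite span_nil => _ ->; apply: submod0.
have sus := submod_span us.
have [b [_ [Bb /span_cons[a [z [us_z ->]] def_n]]]] := Bus n (mem_head _ _).
have [c inv_c] := radx a.
have {}def_n : n = c *: (b + x *: z).
  rewrite -[LHS]scale1r -inv_c -scalerA; congr (_ *: _).
  by rewrite scalerBl scale1r {1}def_n scalerDr scalerA addrA addrAC addrK.
have usB : span us `<=` B.
  apply: IHus => u us_u.
  have [b' [_ [Bb' /span_cons[a' [z' [us_z' ->]] ->]]]] := Bus u (mem_behead (s := n :: us) us_u).
  exists (b' + (x * a' * c) *: b), ((x * a' * c) *: z + z'); split.
  - by apply: submodD => //; apply: submodZ.
  - exact: submodZD.
  rewrite def_n !scalerDr !scalerA !addrA.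
  by congr (_ + _ *: _ + _ *: _ + _); ring.
apply: span_sub => // u; rewrite inE => /orP[/eqP->|/mem_span/usB //].
by rewrite def_n; apply: submodZ => //; apply: submodD => //; apply: submodZ => //; apply: usB.
Qed.

End FinitelyGenerated.

(** * Prime ideals and regular sequences *)

Section Ideals.
Variables (R : comNzRingType) (noethR : noetherian R).
Implicit Types (I J p q m : set R^o) (a b x : R).

Lemma idealrP (I : set R) :
  idealr_closed [in I] <-> submodule (I : set R^o) /\ ~ I 1.
Proof.
split=> [[I0 I1 Ilin]|[/submoduleP[I0 Ilin] I1]].
  split; last by move=> I1'; apply: (negP I1); rewrite inE.
  apply/submoduleP; split; first by move: I0; rewrite inE.
  by move=> a u v Iu Iv; have := Ilin a u v; rewrite !inE; apply.
split; first by rewrite inE.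
  by apply/negP; rewrite inE.
by move=> a u v; rewrite !inE; apply: Ilin.
Qed.

(** Without a maximal member, choice builds a strictly increasing sequence of ideals; its union is
    finitely generated, so it is reached at a finite stage. *)
Lemma noetherian_max (P : set (set R^o)) I0 : P I0 ->
    (forall I, P I -> submodule I) ->
  exists2 I, P I & forall J, P J -> I `<=` J -> J = I.
Proof.
move=> PI0 Psub; apply: contrapT => noMax.
have step (I : {I | P I}) : {J : {J | P J} | proj1_sig I `<` proj1_sig J}.
  case: I => I PI; apply: cid; apply: contrapT => noJ.
  apply: noMax; exists I => // J PJ IJ; apply: contrapT => neqJ.
  apply: noJ; exists (exist P J PJ) => /=; split=> // JI.
  by apply: neqJ; apply/seteqP.
pose C i := proj1_sig (iter i (fun J : {I | P I} => proj1_sig (step J)) (exist P I0 PI0)).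
have CS i : C i `<` C i.+1 by rewrite /C /=; case: (step _).
have PC i : P (C i) by rewrite /C; case: (iter _ _ _).
have homoC i j : (i <= j)%N -> C i `<=` C j.
  move=> /subnK <-; elim: (j - i)%N => [|k IHk]; first exact: subset_refl.
  by apply: subset_trans IHk _; case: (CS (k + i)%N).
pose U : set R^o := [set a | exists i, C i a].
have sU : submodule U.
  apply/submoduleP; split; first by exists 0%N; apply: submod0; apply: Psub.
  move=> a u v [i Cu] [j Cv]; exists (maxn i j).
  apply: submodZD; first exact: Psub.
    by apply: homoC Cu; apply: leq_maxl.
  by apply: homoC Cv; apply: leq_maxr.
have [us spanU] := noethR sU.
have [n usCn] : exists n, forall u, u \in us -> C n u.
  have : forall u, u \in us -> U u by move=> u /mem_span; rewrite spanU.
  elim: us {spanU} => [|u us IHus] usU; first by exists 0%N.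
  have [|n usCn] := IHus; first by move=> v us_v; apply: usU; rewrite inE us_v orbT.
  have [i Ciu] := usU u (mem_head _ _).
  exists (maxn i n) => v; rewrite inE => /orP[/eqP->|/usCn].
    by apply: homoC Ciu; apply: leq_maxl.
  by apply: homoC; apply: leq_maxr.
have [_] := CS n; apply=> u CSu.
have : span us u by rewrite spanU; exists n.+1.
by move: u {CSu}; apply: span_sub => //; apply: Psub.
Qed.

Lemma prime_idealP (p : set R) : prime_ideal p <->
  [/\ submodule (p : set R^o), ~ p 1 & forall a b, p (a * b) -> p a \/ p b].
Proof.
split=> [[/idealrP[sp p1] pp]|[sp p1 pp]]; split=> //.
- by move=> a b; have := pp a b; rewrite !inE => pab /pab /orP[]; rewrite !inE; [left|right].
- exact/idealrP.
- by move=> a b; rewrite inE => /pp[pa|pb]; apply/orP; rewrite !inE; [left|right].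
Qed.

Lemma mem_adjoin1 I a : submodule I -> adjoin I a [set: R^o] a.
Proof.
move=> sI; exists 0, 1; rewrite /GRing.scale /= mulr1 add0r; split=> //.
exact: submod0.
Qed.

(** An ideal [q] maximal among those above [I] that miss [S] is prime: for [a], [b] outside [q] the
    ideals [q] + ([a]) and [q] + ([b]) meet [S], and if [a * b] were in [q], so would be the product
    of two such elements. *)
Lemma prime_avoiding I (S : set R) : submodule I -> S 1 ->
    (forall a b, S a -> S b -> S (a * b)) -> (forall a, I a -> ~ S a) ->
  exists q : set R, [/\ prime_ideal q, I `<=` q & forall a, q a -> ~ S a].
Proof.
move=> sI S1 SM IS.
have [||q [sq Iq qS] qmax] := @noetherian_max
    [set J | [/\ submodule J, I `<=` J & forall a, J a -> ~ S a]] I.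
- by split.
- by move=> J [].
exists q; split=> //; apply/prime_idealP; split=> //; first by move/qS.
have extq a : ~ q a -> exists u c, q u /\ S (u + a * c).
  move=> qa; apply: contrapT => noS; apply: qa.
  have sq' := submod_adjoin a sq (submodT R^o).
  have <- : adjoin q a [set: R^o] = q.
    apply: qmax; last by apply: sub_adjoin; apply: submodT.
    split=> //; first by apply: subset_trans Iq _; apply: sub_adjoin; apply: submodT.
    move=> b [u [c [qu _ ->]]] Sb; apply: noS; exists u, c; split=> //.
  exact: mem_adjoin1.
move=> a b qab; apply: contrapT => /not_orP[/extq[u [c [qu Su]]] /extq[v [d [qv Sv]]]].
apply: (qS _ _ (SM _ _ Su Sv)).
have -> : (u + a * c) * (v + b * d) =
    (v + b * d) *: (u : R^o) + ((a * c) *: (v : R^o) + (c * d) *: (a * b : R^o)).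
  by rewrite /GRing.scale /=; ring.
by apply: submodD => //; [|apply: submodD => //]; apply: submodZ.
Qed.

End Ideals.

(** * Noetherian local rings *)

Section LocalRings.
Variables (R : comNzRingType) (noethR : noetherian R).
Variables (m : set R) (localR : local_ring m).
Implicit Types (I J : set R^o) (a b x : R).

Lemma submod_max : submodule (m : set R^o).
Proof. by case: localR => [[/idealrP[]]]. Qed.

Lemma max1 : ~ m 1.
Proof. by case: localR => [[/idealrP[]]]. Qed.

Lemma proper_sub_max I : submodule I -> ~ I 1 -> I `<=` m.
Proof.
move=> sI I1.
have [||J [sJ J1 IJ] Jmax] := @noetherian_max R noethR
   [set J | [/\ submodule J, ~ J 1 & I `<=` J]] I.
- by split.
- by move=> J [].
suff <- : J = m by [].
case: localR => _; apply; split; first exact/idealrP.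
move=> K /idealrP[sK K1] JK; apply: Jmax => //; split=> //.
exact: subset_trans IJ JK.
Qed.

Lemma unit_notin_max a : ~ m a -> exists b, b * a = 1.
Proof.
move=> ma; have s_a := submod_span [:: a : R^o].
have [] : span [:: a : R^o] 1.
  apply: contrapT => a1; apply: ma; apply: (proper_sub_max s_a a1).
  by apply: mem_span; rewrite inE.
by move=> c; rewrite big_ord1 => c1; exists (c ord0).
Qed.

Lemma max_radical x a : m x -> exists c, c * (1 - x * a) = 1.
Proof.
move=> mx; apply: unit_notin_max => m1; apply: max1.
rewrite -(subrK (x * a) 1); apply: (submodD submod_max) => //.
by rewrite mulrC; apply: (submodZ (M := R^o) _ submod_max).
Qed.

Lemma prime_max : prime_ideal m.
Proof.
apply/prime_idealP; split; [exact: submod_max|exact: max1|].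
move=> a b mab; apply: contrapT => /not_orP[ma mb]; apply: mb.
have [c ca] := unit_notin_max ma.
have -> : b = c * (a * b) by rewrite mulrA ca mul1r.
exact: (submodZ (M := R^o) _ submod_max).
Qed.

(** For an ideal [I] this says that the power J^k lies in [I]. Longer products are included, so that
    [k] may be enlarged at once. *)
Definition prod_in (J : set R) (k : nat) I : Prop :=
  forall s : seq R, (k <= size s)%N -> (forall a, a \in s -> J a) -> I (\prod_(a <- s) a).

(** Otherwise take an ideal [J] above [I] maximal among those containing no power of [m]. It is
    prime, since m^(k+l) lies in (J + (a))(J + (b)), which is inside [J] when [a * b] is. So [J]
    equals [m], which contains its own first power. *)
Lemma max_nilpotent I : submodule I ->
  (forall p, prime_ideal p -> I `<=` p -> p = m) -> exists k, prod_in m k I.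
Proof.
move=> sI primeI; apply: contrapT => nonil.
have [||J [sJ IJ Jnil] Jmax] := @noetherian_max R noethR
   [set J | [/\ submodule J, I `<=` J & ~ exists k, prod_in m k J]] I.
- by split.
- by move=> J [].
have mulJ (J' : set R^o) a b : submodule J' -> J' b -> J' (a * b).
  by move=> sJ' J'b; apply: (submodZ (M := R^o)).
have nil_adjoin a : ~ J a -> exists k, prod_in m k (adjoin J a [set: R^o]).
  move=> Ja; apply: contrapT => nonil_a; apply: Ja.
  have sTo := submodT R^o.
  have sJa := submod_adjoin a sJ sTo.
  have <- : adjoin J a [set: R^o] = J.
    apply: Jmax; last exact: sub_adjoin.
    split=> //; apply: subset_trans IJ _; exact: sub_adjoin.
  exact: mem_adjoin1.
suff Jm : J = m.
  apply: Jnil; rewrite Jm; exists 1%N => -[|a s] // _ ms; rewrite big_cons mulrC.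
  by apply: mulJ; [exact: submod_max | apply: ms; rewrite mem_head].
apply: primeI => //; apply/prime_idealP; split=> //.
  move=> J1; apply: Jnil; exists 0%N => s _ _.
  by rewrite -[X in J X]mulr1; apply: mulJ.
move=> a b Jab; apply: contrapT => /not_orP[/nil_adjoin[k ka] /nil_adjoin[l lb]].
apply: Jnil; exists (k + l)%N => s sz_s ms.
have [||u [c [Ju _ def_u]]] := ka (take k s).
- by rewrite size_take; case: ltnP => //; lia.
- by move=> x /mem_take/ms.
have [||v [d [Jv _ def_v]]] := lb (drop k s).
- by rewrite size_drop; lia.
- by move=> x /mem_drop/ms.
rewrite -(cat_take_drop k s) big_cat /= def_u def_v.
have -> : (u + a *: c) * (v + b *: d) =
    (v + b * d) * u + ((a * c) * v + (c * d) * (a * b)).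
  by rewrite /GRing.scale /=; ring.
by apply: (submodD sJ); [|apply: (submodD sJ)]; apply: mulJ.
Qed.

End LocalRings.

(** * Regular sequences and chains of primes *)

Section RegularSequences.
Variables (R : comNzRingType) (M : lmodType R).
Implicit Types (A N : set M) (xs : seq R).

(** For [N] inside [A]: [x] is a nonzerodivisor on [A] / [N]. *)
Definition regular_mod (x : R) A N := forall u, A u -> N (x *: u) -> N u.

(** Weak regularity on [A] / [N]: the final quotient may be zero. *)
Fixpoint regular_seq A N xs : Prop :=
  if xs is x :: xs' then regular_mod x A N /\ regular_seq A (adjoin N x A) xs'
  else True.

Lemma regular_seq_rcons A N xs x : regular_seq A N (rcons xs x) <->
  regular_seq A N xs /\ regular_mod x A (adjoin_seq A N xs).
Proof.
elim: xs N => [|y xs IHxs] N /=; first by split=> [[]|[]].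
rewrite IHxs; split=> [[? []]|[[]]] //.
Qed.

Definition quotient_annihilator N : set R^o := [set a | forall u, N (a *: u)].

Lemma submod_quotient_annihilator N :
  submodule N -> submodule (quotient_annihilator N).
Proof.
move=> sN; apply/submoduleP; split=> [u|a b c Nb Nc u].
  by rewrite scale0r; apply: submod0.
by rewrite scalerDl -[a *: b]/(a * b) -scalerA; apply: submodZD.
Qed.

Lemma regular_mod_iter x N n u : regular_mod x [set: M] N ->
  N (x ^+ n *: u) -> N u.
Proof.
by move=> regx; elim: n => [|n IHn]; rewrite ?scale1r // exprS -scalerA => /regx/IHn; apply.
Qed.

(* Localizing at [p] shows that a nonzerodivisor on [M / N] avoids some prime below [p]. *)
Lemma regular_prime_below x N (p : set R) : noetherian R -> submodule N ->
    regular_mod x [set: M] N -> prime_ideal p -> quotient_annihilator N `<=` p -> p x ->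
  exists q : set R,
    [/\ prime_ideal q, quotient_annihilator N `<=` q & q `<` p].
Proof.
move=> noethR sN regx /prime_idealP[sp p1 pM] Np px.
(* A prime missing [S] lies in [p] and does not contain [x], hence is strictly smaller than [p]. *)
pose S : set R := [set a | exists n s, ~ p s /\ a = x ^+ n * s].
have [||||q [prq Nq qS]] := prime_avoiding noethR (I := quotient_annihilator N) (S := S).
- exact: submod_quotient_annihilator.
- by exists 0%N, 1; rewrite mul1r.
- move=> _ _ [n [s [ps ->]]] [k [t [pt ->]]]; exists (n + k)%N, (s * t).
  by split; [by move=> /pM[] | rewrite exprD; ring].
(* If [x ^+ n * s] kills [M] / [N], so does [s] by regularity of [x], and then [s] lies in [p]. *)
- move=> a Na [n [s [ps def_a]]]; apply: ps; apply: Np => u.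
  by apply: (regular_mod_iter (n := n) regx); rewrite scalerA -def_a.
exists q; split=> //; split=> [a qa|pq].
  by apply: contrapT => pa; apply: (qS a qa); exists 0%N, a; rewrite mul1r.
apply: (qS x); first exact: pq.
by exists 1%N, 1; rewrite mulr1.
Qed.

(** Each regular element prolongs the chain downwards: the bottom prime of the chain for M / (N +
    xM) contains [x], so there is a smaller prime above the annihilator of [M] / [N]. *)
Lemma regular_seq_chain xs N (p : set R) : noetherian R -> submodule N ->
    regular_seq [set: M] N xs -> prime_ideal p ->
    quotient_annihilator (adjoin_seq [set: M] N xs) `<=` p ->
  exists C : nat -> set R, [/\ C (size xs) = p,
    forall i, (i <= size xs)%N -> prime_ideal (C i) /\ quotient_annihilator N `<=` C i &
    forall i, (i < size xs)%N -> C i `<` C i.+1].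
Proof.
move=> noethR; elim: xs N => [|x xs IHxs] N sN.
  by move=> _ prp Np; exists (fun=> p).
move=> [regx reg_xs] prp Np; have sN' := submod_adjoin x sN (submodT M).
have [C [Cp prC ltC]] := IHxs _ sN' reg_xs prp Np.
have NN' : quotient_annihilator N `<=` quotient_annihilator (adjoin N x [set: M]).
  by move=> a Na u; apply: sub_adjoin => //; apply: submodT.
have [pr0 N'0] := prC 0%N isT.
have [||q [prq Nq ltq]] := regular_prime_below noethR sN regx pr0.
- exact: subset_trans NN' N'0.
- by apply: N'0 => u; apply: adjoin_scale.
exists (fun i => if i is j.+1 then C j else q); split=> //.
  move=> [|i] //= /prC[prCi N'i]; split=> //; exact: subset_trans NN' N'i.
by move=> [_|i]; [exact: ltq | exact: ltC].
Qed.

End RegularSequences.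

(** * Koszul homology *)

Section Koszul.
Variables (R : comNzRingType) (M : lmodType R).
Implicit Types (N : set M) (x y : R) (xs ys : seq R).

(** The Koszul complex as an iterated mapping cone, all degrees in one module. The second component
    of a pair is the coefficient of the new exterior generator. *)
Fixpoint koszul xs : lmodType R :=
  if xs is _ :: xs' then (koszul xs' * koszul xs')%type else M.

Fixpoint kdiff {xs} : koszul xs -> koszul xs :=
  if xs is x :: xs' then fun u => (kdiff u.1 + x *: u.2, - kdiff u.2)
  else fun=> 0.

(** Homogeneous chains. The new generator has degree one, so the second component is shifted, and it
    vanishes in degree zero. *)
Fixpoint kdeg {xs} (j : nat) : set (koszul xs) :=
  if xs is _ :: xs' then
    [set u | kdeg j u.1 /\ (if j is i.+1 then kdeg i u.2 else u.2 = 0)]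
  else if j is 0 then setT else [set 0].

(* Quotients [M / N] are not formed: chains of [K(xs; M / N)] are chains of
   [K(xs; M)] modulo those with entries in [N]. *)
Fixpoint kmod N {xs} : set (koszul xs) :=
  if xs is _ :: xs' then [set u | kmod N u.1 /\ kmod N u.2] else N.

Fixpoint kbase {xs} : M -> koszul xs :=
  if xs is _ :: xs' then fun u => (kbase u, 0) else id.

(* [H_j(xs; M / N) = 0]. *)
Definition koszul_acyclic xs N j : Prop :=
  forall u : koszul xs, kdeg j u -> kmod N (kdiff u) ->
  exists2 w, kdeg j.+1 w & kmod N (u - kdiff w).

Lemma submod_kdeg xs j : submodule (kdeg j : set (koszul xs)).
Proof.
elim: xs j => [|x xs IHxs] [|j] /=.
- exact: submodT.
- exact: submod_zero.
- apply/submoduleP; split=> [|a u v [u1 u2] [v1 v2]].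
    by split=> //; apply: submod0; apply: IHxs.
  by split; [apply: submodZD | rewrite /= u2 v2 scaler0 addr0].
apply/submoduleP; split=> [|a u v [u1 u2] [v1 v2]].
  by split; apply: submod0.
by split; apply: submodZD.
Qed.

Lemma submod_kmod N xs : submodule N -> submodule (kmod N : set (koszul xs)).
Proof.
move=> sN; elim: xs => [|x xs IHxs] //=.
apply/submoduleP; split=> [|a u v [u1 u2] [v1 v2]].
  by split; apply: submod0.
by split; apply: submodZD.
Qed.

Lemma kdiffP xs a (u v : koszul xs) : kdiff (a *: u + v) = a *: kdiff u + kdiff v.
Proof.
elim: xs a u v => [|x xs IHxs] a u v /=; first by rewrite scaler0 addr0.
congr (_, _); rewrite /= !IHxs.
  by rewrite !scalerDr !scalerA mulrC addrACA.
by rewrite opprD scalerN.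
Qed.

Lemma kdiff0 xs : kdiff (0 : koszul xs) = 0.
Proof.
by have := kdiffP (-1) (0 : koszul xs) 0; rewrite scaler0 addr0 scaleN1r addNr.
Qed.

Lemma kdiffZ xs a (u : koszul xs) : kdiff (a *: u) = a *: kdiff u.
Proof. by rewrite -[a *: u]addr0 kdiffP kdiff0 addr0. Qed.

Lemma kdiffD xs (u v : koszul xs) : kdiff (u + v) = kdiff u + kdiff v.
Proof. by rewrite -[u]scale1r kdiffP !scale1r. Qed.

Lemma kdiffN xs (u : koszul xs) : kdiff (- u) = - kdiff u.
Proof. by rewrite -scaleN1r kdiffZ scaleN1r. Qed.

Lemma kdiffK xs (u : koszul xs) : kdiff (kdiff u) = 0.
Proof.
elim: xs u => [|x xs IHxs] u //=.
rewrite [RHS](_ : _ = (0, 0) :> koszul xs * koszul xs) //.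
by congr (_, _); rewrite ?kdiffN ?kdiffD !IHxs ?kdiffZ ?add0r ?scalerN ?subrr ?oppr0.
Qed.

Lemma kdeg0_diff xs (u : koszul xs) : kdeg 0 u -> kdiff u = 0.
Proof.
elim: xs u => [|x xs IHxs] u //= [/IHxs -> ->].
by rewrite kdiff0 scaler0 addr0 oppr0.
Qed.

Lemma kdeg_diff xs j (u : koszul xs) : kdeg j.+1 u -> kdeg j (kdiff u).
Proof.
elim: xs j u => [|x xs IHxs] j u /=; first by move=> _; case: j.
case=> u1 u2; split.
  exact: submodD (submod_kdeg _ _) (IHxs _ _ u1) (submodZ _ (submod_kdeg _ _) u2).
case: j u1 u2 => [|j] _ u2; first by rewrite kdeg0_diff // oppr0.
exact: submodN (submod_kdeg _ _) (IHxs _ _ u2).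
Qed.

Lemma kdeg_gt xs j (u : koszul xs) : (size xs < j)%N -> kdeg j u -> u = 0.
Proof.
elim: xs j u => [|x xs IHxs] [|j] //= [u v]; rewrite ltnS => lt_j /= [u1 u2].
by rewrite (IHxs _ _ (leqW lt_j) u1) (IHxs _ _ lt_j u2).
Qed.

Lemma kmod_diff N xs (u : koszul xs) : submodule N -> kmod N u -> kmod N (kdiff u).
Proof.
move=> sN; elim: xs u => [|x xs IHxs] u /=; first by move=> _; apply: submod0.
case=> u1 u2; have sK := submod_kmod xs sN.
split; last by apply: submodN => //; apply: IHxs.
by apply: submodD => //; [apply: IHxs | apply: submodZ].
Qed.

Lemma kmod_regular N xs y (u : koszul xs) : regular_mod y [set: M] N ->
  kmod N (y *: u) -> kmod N u.
Proof.
move=> regy; elim: xs u => [|x xs IHxs] u /=; first exact: regy.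
by case=> /IHxs u1 /IHxs u2.
Qed.

(** The entries are split one by one, as 0 + 0 wherever the degree makes the entry vanish; this
    keeps [w] homogeneous. *)
Lemma kmod_adjoin N xs y j (u : koszul xs) : submodule N -> kdeg j u ->
    kmod (adjoin N y [set: M]) u ->
  exists v w, [/\ kmod N v, kdeg j w & u = v + y *: w].
Proof.
move=> sN; elim: xs j u => [|x xs IHxs] j u /=.
  case: j => [_|j -> _] ; first by case=> v [w [Nv _ def_u]]; exists v, w.
  by exists 0, 0; rewrite scaler0 addr0; split=> //; apply: submod0.
case: j => [|j] [u1 u2] [/(IHxs _ _ u1)[v1 [w1 [Nv1 w1j def1]]] N2].
  exists (v1, 0), (w1, 0); split=> //=; first by split=> //; apply: submod0; apply: submod_kmod.
  by case: u def1 u2 {u1 N2} => u1 u2 /= -> ->; congr (_, _); rewrite /= scaler0 addr0.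
have [v2 [w2 [Nv2 w2j def2]]] := IHxs _ _ u2 N2.
exists (v1, v2), (w1, w2); split=> //=.
by case: u def1 def2 {u1 u2 N2} => u1 u2 /= -> ->.
Qed.

(** The homotopy is exterior multiplication by an element of degree one with boundary [a], built
    along the cones. It shows that [a] kills the Koszul homology. *)
Lemma koszul_homotopy xs a : span (xs : seq R^o) a ->
  exists h : koszul xs -> koszul xs,
  [/\ forall c u v, h (c *: u + v) = c *: h u + h v,
      forall j u, kdeg j u -> kdeg j.+1 (h u),
      forall N u, submodule N -> kmod N u -> kmod N (h u)
    & forall u, kdiff (h u) + h (kdiff u) = a *: u].
Proof.
elim: xs a => [|x xs IHxs] a.
  rewrite span_nil => ->; exists (fun=> 0); split=> //.
  - by move=> c u v; rewrite scaler0 addr0.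
  - by move=> N u sN _; apply: submod0.
  by move=> u; rewrite scale0r addr0.
case/span_cons=> c [b [/IHxs[h [hlin hdeg hmod hK]] ->]].
exists (fun u => (h u.1, c *: u.1 - h u.2)); split.
- move=> d u v; congr (_, _); rewrite /= hlin //.
  by rewrite !scalerDr !scalerA [c * d]mulrC scalerN opprD addrACA.
- move=> [|j] u /= [u1 u2]; split; try exact: hdeg.
    apply: submodB; [exact: submod_kdeg | apply: submodZ => //; exact: submod_kdeg |].
    have -> : h u.2 = 0; last by apply: submod0; apply: submod_kdeg.
    by rewrite u2; have := hlin (-1) 0 0; rewrite scaler0 addr0 scaleN1r addNr.
  apply: submodB; [exact: submod_kdeg | apply: submodZ => //; exact: submod_kdeg |].
  exact: hdeg.
- move=> N u sN /= [u1 u2]; have sK := submod_kmod xs sN.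
  by split; [apply: hmod | apply: submodB => //; [apply: submodZ | apply: hmod]].
move=> u; have hN v : h (- v) = - h v.
  have h0 : h 0 = 0 by have := hlin (-1) 0 0; rewrite scaler0 addr0 scaleN1r addNr.
  by rewrite -[- v]addr0 -scaleN1r hlin h0 addr0 scaleN1r.
have hD c' v w : h (v + c' *: w) = h v + c' *: h w by rewrite addrC hlin addrC.
congr (_, _); rewrite /=.
  rewrite hD -[c *: (x : R^o)]/(c * x) scalerDl -hK scalerBr scalerA [x * c]mulrC.
  by rewrite addrACA subrK addrC.
rewrite hN opprK kdiffD kdiffZ kdiffN opprB -[c *: (x : R^o)]/(c * x) scalerDl -hK.
by rewrite scalerDr scalerA -!addrA addKr addrCA.
Qed.

Section Step.
Variables (N : set M) (xs : seq R) (y : R).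
Hypotheses (sN : submodule N) (regy : regular_mod y [set: M] N).

(** In the long exact sequence of multiplication by [y] on [M] / [N], the kernel of [y] on H_j comes
    from H_(j+1) of M / (N + yM), which vanishes. The connecting map is unwound on chains. *)
Lemma koszul_regular_inj j (u w : koszul xs) :
    koszul_acyclic xs (adjoin N y [set: M]) j.+1 ->
    kdeg j u -> kdeg j.+1 w -> kmod N (kdiff u) -> kmod N (y *: u - kdiff w) ->
  exists2 w' : koszul xs, kdeg j.+1 w' & kmod N (u - kdiff w').
Proof.
move=> acy uj wj Du Dw; have sK := submod_kmod xs sN.
have sNy := submod_adjoin y sN (submodT M).
have NNy (v : koszul xs) : kmod N v -> kmod (adjoin N y [set: M]) v.
  elim: xs v {u w uj wj Du Dw sK acy} => [|x s IHs] /= v.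
    by apply: sub_adjoin; apply: submodT.
  by case=> /IHs ? /IHs.
have yK (v : koszul xs) : kmod (adjoin N y [set: M]) (y *: v).
  elim: xs v {u w uj wj Du Dw sK acy NNy} => [|x s IHs] /= v.
    exact: adjoin_scale.
  by split; apply: IHs.
(* Modulo [N] + [y] [M] the chain [w] is a cycle, hence the boundary of some [v]. The difference
   [w - kdiff v] then splits as [n + y *: w'], and [w'] bounds [u] modulo [N]. *)
have [|v vj Dv] := acy w wj.
  rewrite -[kdiff w](subKr (y *: u)); apply: submodB; [exact: submod_kmod| exact: yK|].
  exact: NNy.
have wvj : kdeg j.+1 (w - kdiff v).
  by apply: submodB; [exact: submod_kdeg| exact: wj|exact: kdeg_diff].
have [n [w' [Nn w'j def_w]]] := kmod_adjoin sN wvj Dv.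
exists w' => //; apply: (kmod_regular regy).
rewrite scalerBr -kdiffZ.
have -> : kdiff (y *: w') = kdiff w - kdiff n.
  rewrite -[w](subrK (kdiff v)) def_w !kdiffD kdiffK addr0 addrC addKr //.
rewrite opprB addrCA; apply: submodD => //; exact: kmod_diff.
Qed.

(** On H_j multiplication by [y] is injective, while [y ^+ k] acts as zero by the homotopy; so H_j
    vanishes. *)
Lemma koszul_acyclic_step j k : span (xs : seq R^o) (y ^+ k) ->
  koszul_acyclic xs (adjoin N y [set: M]) j.+1 -> koszul_acyclic xs N j.
Proof.
move=> yk acy u uj Du; have [h [hlin hdeg hmod hK]] := koszul_homotopy yk.
have sK := submod_kmod xs sN.
have : kmod N (y ^+ k *: u - kdiff (h u)) by rewrite -hK addrC addKr; apply: hmod.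
move: (h u) (hdeg _ _ uj) => {h hlin hdeg hmod hK}.
elim: k {yk} => [|k IHk] w wj; first by rewrite scale1r; exists w.
have uj' := submodZ (y ^+ k) (submod_kdeg _ _) uj.
rewrite exprS -scalerA => /(koszul_regular_inj acy uj' wj)[].
  by rewrite kdiffZ; apply: submodZ.
by move=> w'; apply: IHk.
Qed.

End Step.

(** Depth sensitivity of Koszul homology: passing to the quotient by one entry of [ys] raises the
    degree by one, and there are no nonzero chains in degrees above [size xs]. *)
Lemma regular_koszul_acyclic xs ys N j : submodule N -> regular_seq [set: M] N ys ->
    (forall y, y \in ys -> exists k, span (xs : seq R^o) (y ^+ k)) ->
  (size xs < j + size ys)%N -> koszul_acyclic xs N j.
Proof.
move=> sN; elim: ys N j sN => [|y ys IHys] N j sN /=.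
  rewrite addn0 => _ _ lt_j u /(kdeg_gt lt_j) -> _; exists 0.
    exact: submod0 (submod_kdeg _ _).
  by rewrite kdiff0 subr0; apply: submod0 (submod_kmod _ _).
move=> [regy regys] nil lt_j; have [k yk] := nil y (mem_head _ _).
apply: koszul_acyclic_step yk _ => //; apply: IHys => //.
- exact: submod_adjoin (submodT M).
- by move=> z ys_z; apply: nil; rewrite inE ys_z orbT.
by rewrite addSnnS.
Qed.

Lemma kbaseP xs a u v : kbase (a *: u + v) = a *: kbase u + kbase v :> koszul xs.
Proof. by elim: xs => //= x xs ->; congr (_, _); rewrite /= scaler0 addr0. Qed.

Lemma kbase0 xs : kbase 0 = 0 :> koszul xs.
Proof. by elim: xs => //= x xs ->. Qed.

Lemma kbaseZ xs a u : kbase (a *: u) = a *: kbase u :> koszul xs.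
Proof. by rewrite -[a *: u]addr0 kbaseP kbase0 addr0. Qed.

Lemma kdeg_base xs u : kdeg 0 (kbase u : koszul xs).
Proof. by elim: xs. Qed.

Lemma kdeg0_base xs (u : koszul xs) : kdeg 0 u -> exists v, u = kbase v.
Proof.
elim: xs u => [|x xs IHxs] /= u; first by exists u.
by case: u => u1 u2 /= [/IHxs[v ->] ->]; exists v.
Qed.

Lemma kmod_base N xs u : submodule N -> kmod N (kbase u : koszul xs) <-> N u.
Proof.
move=> sN; elim: xs => //= x xs IHxs; split=> [[/IHxs //]|Nu].
by split; [apply/IHxs | apply: submod0 (submod_kmod _ _)].
Qed.

(** Together with [adjoin_seq_boundary] this identifies H_0(xs; M / N) with the quotient of [M] by
    [N] + ([xs]) [M]. *)
Lemma kdeg1_diff N xs (w : koszul xs) : submodule N -> kdeg 1 w ->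
  exists2 u, kdiff w = kbase u & adjoin_seq [set: M] N xs u.
Proof.
move=> sN; elim: xs N w sN => [|x xs IHxs] N w sN /=.
  by move=> _; exists 0 => //; apply: submod0.
have sNx := submod_adjoin x sN (submodT M).
case=> /(IHxs _ _ sNx)[u -> Nu] w2; have [v def_v] := kdeg0_base w2.
exists (x *: v + u).
  by rewrite kbaseP def_v kdeg0_diff ?oppr0 1?addrC //; apply: kdeg_base.
apply: submodD => //; first by apply: submod_adjoin_seq => //; apply: submodT.
by apply: sub_adjoin_seq; [apply: submodT | apply: adjoin_scale].
Qed.

Lemma adjoin_seq_boundary N xs u : submodule N -> adjoin_seq [set: M] N xs u ->
  exists2 w : koszul xs, kdeg 1 w & kmod N (kbase u - kdiff w).
Proof.
move=> sN; have sK := submod_kmod xs sN.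
pose L : set M := [set v | exists2 w : koszul xs, kdeg 1 w & kmod N (kbase v - kdiff w)].
have sL : submodule L.
  apply/submoduleP; split.
    exists 0; first exact: submod0 (submod_kdeg _ _).
    by rewrite kbase0 kdiff0 subr0; apply: submod0.
  move=> a v v' [w w1 Nw] [w' w'1 Nw']; exists (a *: w + w').
    exact: submodZD (submod_kdeg _ _) _ _.
  by rewrite kbaseP kdiffP opprD addrACA -scalerBr; apply: submodZD.
apply: (adjoin_seq_sub (L := L)) => // [v Nv|x v xs_x _].
  exists 0; first exact: submod0 (submod_kdeg _ _).
  by rewrite kdiff0 subr0; apply/kmod_base.
(* As [kbase v] is a cycle, the homotopy for [x] makes [x *: kbase v] a boundary. *)
have [h [hlin hdeg hmod hK]] := koszul_homotopy (mem_span (xs_x : (x : R^o) \in (xs : seq R^o))).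
exists (h (kbase v)); first by apply: hdeg; apply: kdeg_base.
have h0 : h 0 = 0 by have := hlin (-1) 0 0; rewrite scaler0 addr0 scaleN1r addNr.
have := hK (kbase v); rewrite (kdeg0_diff (kdeg_base _ v)) h0 addr0.
by move=> ->; rewrite kbaseZ subrr; apply: submod0.
Qed.

Lemma koszul_finitely_generated xs :
  finitely_generated M -> finitely_generated (koszul xs).
Proof.
move=> fgM; elim: xs => //= x xs [us spanK].
exists ([seq (u, 0) | u <- us] ++ [seq (0, u) | u <- us]).
apply/seteqP; split=> // -[u v] _; set ws := (X in span X).
have sS := submod_span ws.
have : forall z, span us z -> span ws (z, 0) /\ span ws (0, z).
  pose L : set (koszul xs) := [set z | span ws (z, 0) /\ span ws (0, z)].
  have sL : submodule L.
    apply/submoduleP; split; first by split; exact: (submod0 sS).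
    move=> a z z' [z1 z2] [z'1 z'2]; split.
      have := submodZD a sS z1 z'1.
      by congr (span ws _); congr (_, _); rewrite /= scaler0 addr0.
    have := submodZD a sS z2 z'2.
    by congr (span ws _); congr (_, _); rewrite /= scaler0 addr0.
  move=> z; apply: (span_sub sL) => w us_w; split; apply: mem_span; rewrite mem_cat.
    by rewrite map_f.
  by rewrite map_f ?orbT.
rewrite spanK => spanP; have [u1 _] := spanP u I; have [_ v2] := spanP v I.
have := submodD sS u1 v2; congr (span ws _).
by congr (_, _); rewrite /= ?addr0 ?add0r.
Qed.

(** In the long exact sequence of the cone of [x], vanishing in positive degrees makes [x]
    surjective on the positive homology for [xs], which is then zero by Nakayama, and injective on
    H_0. *)
Lemma koszul_rigid x xs N : noetherian R -> finitely_generated M ->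
    (forall a, exists c, c * (1 - x * a) = 1) -> submodule N ->
    (forall j, koszul_acyclic (x :: xs) N j.+1) ->
  (forall j, koszul_acyclic xs N j.+1) /\
  regular_mod x [set: M] (adjoin_seq [set: M] N xs).
Proof.
move=> noethR fgM radx sN acy; have sK := submod_kmod xs sN.
split=> [j u uj Du|u _ Nxu].
  pose Z : set (koszul xs) := [set v | kdeg j.+1 v /\ kmod N (kdiff v)].
  pose B : set (koszul xs) :=
    [set v | exists2 w, kdeg j.+2 w & kmod N (v - kdiff w)].
  have sZ : submodule Z.
    apply/submoduleP; split.
      by split; [apply: submod0 (submod_kdeg _ _) | rewrite kdiff0; apply: submod0].
    move=> a v v' [v1 v2] [v'1 v'2]; split; first exact: submodZD (submod_kdeg _ _) _ _.
    by rewrite kdiffP; apply: submodZD.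
  have sB : submodule B.
    apply/submoduleP; split.
      exists 0; first exact: submod0 (submod_kdeg _ _).
      by rewrite kdiff0 subr0; apply: submod0.
    move=> a v v' [w w1 Nw] [w' w'1 Nw']; exists (a *: w + w').
      exact: submodZD (submod_kdeg _ _) _ _.
    by rewrite kdiffP opprD addrACA -scalerBr; apply: submodZD.
  have [us spanZ] := fg_noetherian noethR (koszul_finitely_generated xs fgM) sZ.
  suff : Z `<=` B by apply; split.
  rewrite -spanZ; apply: (nakayama radx sB) => v; rewrite spanZ => /mem_span.
  rewrite spanZ => -[vj Dv].
  (* The cycle (v, 0) of the cone is a boundary modulo [N], which writes [v] as a boundary plus [x]
     times the cycle [w2]. *)
  have [||[w1 w2] /= [w1j w2j] [Nw1 Nw2]] := acy j (v, 0) => /=.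
  - by split=> //; apply: submod0 (submod_kdeg _ _).
  - by rewrite scaler0 addr0 kdiff0 oppr0; split=> //; apply: submod0.
  exists (v - x *: w2), w2; split; last by rewrite subrK.
    by exists w1 => //; rewrite -addrA -opprD [_ + kdiff _]addrC.
  by split=> //; move: Nw2; rewrite sub0r opprK.
have [w w1 Nw] := adjoin_seq_boundary sN Nxu.
(* Since [w] bounds [x *: u] modulo [N], this pair is a cycle of degree one. That it is a boundary
   says in its second component that [u] is zero in H_0. *)
have [||[w1' w2'] /= [_ w2j] [_ Nw2]] := acy 0%N (- w, kbase u) => /=.
- by split; [apply: submodN (submod_kdeg _ _) w1 | apply: kdeg_base].
- rewrite (kdeg0_diff (kdeg_base _ _)) oppr0 kdiffN -kbaseZ addrC.
  by split=> //; apply: submod0.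
have [v def_v Nv] := kdeg1_diff sN w2j.
move: Nw2; rewrite def_v opprK -[kbase u]scale1r -kbaseP scale1r kmod_base // => Nuv.
have sX := submod_adjoin_seq xs (submodT M) sN.
rewrite -[u](addrK v); apply: (submodB sX) => //.
by apply: sub_adjoin_seq Nuv; apply: submodT.
Qed.

(** The rigidity step strips the head of [xs] and shows it regular modulo the rest; so the head
    comes last in the regular sequence, whence [rev]. *)
Lemma koszul_acyclic_regular xs N : noetherian R -> finitely_generated M ->
    (forall x a, x \in xs -> exists c, c * (1 - x * a) = 1) -> submodule N ->
    (forall j, koszul_acyclic xs N j.+1) ->
  regular_seq [set: M] N (rev xs).
Proof.
move=> noethR fgM rad sN; elim: xs rad => //= x xs IHxs rad acy.
have radx a : exists c, c * (1 - x * a) = 1 by apply: rad; rewrite mem_head.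
have [acy' regx] := koszul_rigid noethR fgM radx sN acy.
rewrite rev_cons; apply/regular_seq_rcons; split.
  by apply: IHxs => // y a xs_y; apply: rad; rewrite inE xs_y orbT.
rewrite (@eq_mem_adjoin_seq _ _ _ _ (rev xs) xs) //; first exact: submodT.
exact: mem_rev.
Qed.

(** The regular sequence [ys] makes all H_j(xs; M / N) with j > 0 vanish, and this in turn makes
    [xs] regular. *)
Lemma parameters_regular xs ys N : noetherian R -> finitely_generated M ->
    (forall x a, x \in xs -> exists c, c * (1 - x * a) = 1) -> submodule N ->
    regular_seq [set: M] N ys -> size xs = size ys ->
    (forall y, y \in ys -> exists k, span (xs : seq R^o) (y ^+ k)) ->
  regular_seq [set: M] N xs.
Proof.
move=> noethR fgM rad sN regys eq_sz nil; rewrite -[xs]revK.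
apply: koszul_acyclic_regular => // [x a|j]; first by rewrite mem_rev; apply: rad.
apply: regular_koszul_acyclic regys _ _ => // [y /nil[k yk]|].
  by exists k; apply: span_subset yk => x; rewrite mem_rev.
by rewrite size_rev eq_sz addSn ltnS leq_addl.
Qed.

End Koszul.

(** * Lengths *)

Section Lengths.
Variables (R : comNzRingType) (M : lmodType R).
Implicit Types (N A L : set M) (x : R) (xs : seq R).

Definition interval N A : set (set M) :=
  [set L | [/\ submodule L, N `<=` L & L `<=` A]].

(** Lower and upper bounds on the length of [A] / [N] are separate predicates, so that neither
    presupposes that the length is finite. *)
Definition length_ge N A k : Prop := has_chain (interval N A) k.
Definition length_le N A c : Prop := forall k, length_ge N A k -> (k <= c)%N.

Lemma length_ge0 N A : submodule A -> N `<=` A -> length_ge N A 0.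
Proof. by move=> sA NA; exists (fun=> A); split=> // i _; split=> //; exact: subset_refl. Qed.

Lemma length_ge1 N A : submodule N -> submodule A -> N `<` A -> length_ge N A 1.
Proof.
move=> sN sA [NA AN]; exists (fun i => if i is 0 then N else A); split.
  by move=> [|i] _; split=> //; exact: subset_refl.
by move=> [|i] // _.
Qed.

Lemma length_ge_cat N L A a b : N `<=` L -> L `<=` A ->
  length_ge N L a -> length_ge L A b -> length_ge N A (a + b).
Proof.
move=> NL LA [C [PC ltC]] [D [PD ltD]].
(* The member [D 0] is skipped; it lies above [L], hence above [C a], so the step from [C a] to
   [D 1] is strict. *)
exists (fun i => if (i <= a)%N then C i else D (i - a)%N); split=> i le_i.
  case: leqP => [/PC[]|lt_i].
    by move=> sC NC CL; split=> //; apply: subset_trans LA.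
  have [|sD LD DA] := PD (i - a)%N; first by lia.
  by split=> //; apply: subset_trans LD.
case: (leqP i.+1 a) => [lt_ia|le_ai]; first by rewrite (ltnW lt_ia); apply: ltC.
case: leqP => [le_ia|lt_ai]; last by rewrite subSn 1?ltnW //; apply: ltD; lia.
have -> : i = a by apply/eqP; rewrite eqn_leq le_ia.
have [_ _ CL] := PC a (leqnn a).
have b_gt0 : (0 < b)%N by lia.
have [_ LD _] := PD 0%N isT; have [D01 D10] := ltD 0%N b_gt0.
rewrite subSnn; split; first by apply: subset_trans D01; apply: subset_trans LD.
by move=> DC; apply: D10; apply: subset_trans DC _; apply: subset_trans LD.
Qed.

(** Repetitions are dropped, and [s] counts the strict steps. The last member is recorded for the
    induction. *)
Lemma weak_chain (P : set (set M)) (D : nat -> set M) k :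
    (forall i, (i <= k)%N -> P (D i)) -> (forall i, (i < k)%N -> D i `<=` D i.+1) ->
  let s := (\sum_(i < k) `[< ~ D i.+1 `<=` D i >])%N in
  exists C : nat -> set M, [/\ forall i, (i <= s)%N -> P (C i),
    forall i, (i < s)%N -> C i `<` C i.+1 & C s = D k].
Proof.
elim: k => [|k IHk] PD leD /=.
  by exists D; rewrite big_ord0; split=> // i; rewrite leqn0 => /eqP->; apply: PD.
have [|i lt_ik|C [PC ltC Ck]] := IHk; first by move=> i le_i; apply: PD; apply: leqW.
  by apply: leD; apply: ltnW.
rewrite big_ord_recr /=; set s := (\sum_(i < k) _)%N in PC ltC Ck *.
case: asboolP => [strict|]; last first.
  move=> /contrapT Dk; rewrite addn0; exists C; split=> //.
  by rewrite Ck; apply/seteqP; split=> //; apply: leD.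
rewrite addn1; exists (fun i => if (i <= s)%N then C i else D k.+1); split.
- by move=> i _; case: leqP => [/PC //|_]; apply: PD.
- move=> i /=; rewrite ltnS => le_is; rewrite le_is; case: ltnP => [|le_si].
    exact: ltC.
  have -> : i = s by apply/eqP; rewrite eqn_leq le_is.
  by rewrite Ck; split=> //; apply: leD.
by rewrite ltnn.
Qed.

(** A chain [C] is intersected with [L] and added to [L]. By the modular law each strict step of [C]
    stays strict in at least one of the two chains. *)
Lemma length_le_add N L A a b : submodule A -> submodule L -> N `<=` L -> L `<=` A ->
  length_le N L a -> length_le L A b -> length_le N A (a + b).
Proof.
move=> sA sL NL LA lea leb k [C [PC ltC]].
have [|i lt_i|C1 [PC1 ltC1 _]] := @weak_chain (interval N L) (fun i => C i `&` L) k.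
- move=> i /PC[sC NC CA]; split; [exact: submodI | | exact: subIsetr].
  by move=> u Nu; split; [apply: NC | apply: NL].
- by move=> u [Cu Lu]; split=> //; have [+ _] := ltC i lt_i; apply.
have [|i lt_i|C2 [PC2 ltC2 _]] := @weak_chain (interval L A) (fun i => add_submod (C i) L) k.
- move=> i /PC[sC NC CA]; split; first exact: submod_add.
    by move=> u Lu; exists 0, u; rewrite add0r; split=> //; apply: submod0.
  by move=> _ [v [w [/CA Av /LA Aw ->]]]; apply: submodD.
- move=> u [v [w [Cv Lw ->]]]; exists v, w; split=> //.
  by have [+ _] := ltC i lt_i; apply.
set s1 := (\sum_(i < k) _)%N in PC1 ltC1; set s2 := (\sum_(i < k) _)%N in PC2 ltC2.
have le1 : (s1 <= a)%N by apply: lea; exists C1.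
have le2 : (s2 <= b)%N by apply: leb; exists C2.
apply: leq_trans (leq_add le1 le2); rewrite /s1 /s2 -big_split /=.
rewrite -[k in (k <= _)%N]card_ord -sum1_card; apply: leq_sum => i _.
have [lt1 lt2] := ltC i (ltn_ord i).
case: asboolP => // /contrapT CL; case: asboolP => // /contrapT CaL.
case: lt2 => u Cu; have [|v [w [Cv Lw def_u]]] := CaL u.
  by exists u, 0; rewrite addr0; split=> //; apply: submod0.
rewrite def_u; have [sCi _ _] := PC i (ltnW (ltn_ord i)).
have [sCi' _ _] := PC i.+1 (ltn_ord i).
apply: submodD => //; apply: (CL _ _).1; split=> //.
have -> : w = u - v by rewrite def_u addrC addKr.
by apply: submodB => //; apply: lt1.
Qed.

Lemma length_ge_sub N N' A A' k : N' `<=` N -> A `<=` A' ->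
  length_ge N A k -> length_ge N' A' k.
Proof.
move=> NN AA [C [PC ltC]]; exists C; split=> // i /PC[sC NC CA].
by split=> //; [apply: subset_trans NC | apply: subset_trans AA].
Qed.

Lemma length_le_sub N N' A A' c : N' `<=` N -> A `<=` A' ->
  length_le N' A' c -> length_le N A c.
Proof. by move=> NN AA lec k /(length_ge_sub NN AA); apply: lec. Qed.

End Lengths.

(** Serves instead of isomorphisms of subquotients: a strictly monotone map on submodules transports
    chains. *)
Lemma length_ge_map (R : comNzRingType) (M M' : lmodType R) (N A : set M)
    (N' A' : set M') (phi : set M -> set M') k :
    (forall L, interval N A L -> interval N' A' (phi L)) ->
    (forall L L', interval N A L -> interval N A L' -> L `<=` L' -> phi L `<=` phi L') ->
    (forall L L', interval N A L -> interval N A L' -> L `<=` L' ->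
       phi L' `<=` phi L -> L' `<=` L) ->
  length_ge N A k -> length_ge N' A' k.
Proof.
move=> Pphi homo inj [C [PC ltC]]; exists (phi \o C).
split=> i lt_i; first exact/Pphi/PC.
have [le1 le2] := ltC i lt_i; have PCi := PC i (ltnW lt_i); have PCi' := PC _ lt_i.
split; first exact: homo.
by move/(inj _ _ PCi PCi' le1).
Qed.

(** * Lengths modulo powers of the entries of a sequence *)

Section PowerLengths.
Variables (R : comNzRingType) (M : lmodType R).
Implicit Types (N L : set M) (x : R) (xs : seq R).
Local Notation T := [set: M].

Lemma adjoin_mono N N' x L L' : N `<=` N' -> L `<=` L' -> adjoin N x L `<=` adjoin N' x L'.
Proof. by move=> NN LL _ [v [w [/NN Nv /LL Lw ->]]]; exists v, w. Qed.

Lemma adjoin_expS N x n : adjoin N (x ^+ n.+1) T `<=` adjoin N (x ^+ n) T.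
Proof.
move=> _ [v [w [Nv _ ->]]]; exists v, (x *: w); split=> //.
by rewrite scalerA -exprSr.
Qed.

Lemma adjoin_exp0 N x : submodule N -> adjoin N (x ^+ 0) T = T.
Proof.
by move=> sN; apply/seteqP; split=> // u _; rewrite -[u]scale1r; apply: adjoin_scale.
Qed.

(** The powers of [x] filter the quotient in [n] layers. By regularity the map sending [L] to [N] +
    x^n [L] embeds the submodules above [N] + [x] [M] in each layer. *)
Lemma length_ge_exp N x l n : submodule N -> regular_mod x T N ->
  length_ge (adjoin N x T) T l -> length_ge (adjoin N (x ^+ n) T) T (n * l).
Proof.
move=> sN regx gel; elim: n => [|n IHn].
  exact: length_ge0 (submodT M) _.
rewrite mulSn; apply: length_ge_cat IHn => //; first exact: adjoin_expS.
have adjX L : submodule L -> N `<=` L -> forall v, adjoin N (x ^+ n) L (x ^+ n *: v) -> L v.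
  move=> sL NL v [u [w [Nu Lw def_v]]]; rewrite -[v](subrK w); apply: submodD => //.
  apply: NL; apply: (regular_mod_iter (n := n) regx).
  by rewrite scalerBr def_v addrK.
apply: (length_ge_map (phi := adjoin N (x ^+ n))) gel => /=.
- move=> L [sL NL _]; split; [exact: submod_adjoin | | exact: adjoin_mono].
  move=> _ [v [w [Nv _ ->]]]; exists v, (x *: w); rewrite scalerA -exprSr; split=> //.
  by apply: NL; apply: adjoin_scale.
- by move=> L L' _ _ LL'; apply: adjoin_mono.
move=> L L' [sL NL _] _ _ ll v L'v; apply: adjX => //.
  by apply: subset_trans NL; apply: sub_adjoin; apply: submodT.
by apply: ll; apply: adjoin_scale.
Qed.

(** Multiplication by x^n maps M / (N + xM) onto the layer number [n], so chains in the layer are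
    pulled back. *)
Lemma length_le_exp N x l n : submodule N ->
  length_le (adjoin N x T) T l -> length_le (adjoin N (x ^+ n) T) T (n * l).
Proof.
move=> sN lel; elim: n => [|n IHn].
  move=> k [C [PC ltC]]; case: k PC ltC => // k PC ltC.
  have [_] := ltC 0%N isT; case; have [_ + _] := PC 0%N isT.
  by rewrite adjoin_exp0 // => TC u _; apply: TC.
rewrite mulSn; apply: length_le_add IHn => //.
- exact: submodT.
- exact: submod_adjoin (submodT M).
-  exact: adjoin_expS.
move=> k gek; apply: lel.
apply: (length_ge_map (phi := fun L => [set v | L (x ^+ n *: v)])) gek => /=.
- move=> L [sL NL _]; split=> //; last first.
    move=> _ [v [w [Nv _ ->]]] /=; apply: NL; rewrite scalerDr scalerA -exprSr.
    by exists (x ^+ n *: v), w; split=> //; apply: submodZ.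
  apply/submoduleP; split=> [|a u v Lu Lv] /=; first by rewrite scaler0; apply: submod0.
  by rewrite scalerDr scalerA mulrC -scalerA; apply: submodZD.
- by move=> L L' _ _ LL' v /LL'.
move=> L L' [sL NL _] [sL' NL' L'A] LL' ll u L'u.
have [v [w [Nv _ def_u]]] := L'A u L'u.
have Lv : L v by apply: NL; apply: sub_adjoin => //; apply: submodT.
rewrite def_u; apply: submodD => //; apply: ll => /=.
have -> : x ^+ n *: w = u - v by rewrite def_u addrC addKr.
by apply: submodB => //; apply: LL'.
Qed.

Lemma adjoin_seq_cat_cons xs s x : adjoin_seq T [set 0] (s ++ x :: xs) =
  adjoin (adjoin_seq T [set 0] (s ++ xs)) x T.
Proof.
rewrite -adjoin_seq_rcons; apply: eq_mem_adjoin_seq; [exact: submodT|exact: submod_zero|].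
by move=> y; rewrite mem_rcons !(mem_cat, inE) orbCA.
Qed.

(** The entries are replaced by powers one at a time; [s] collects those already treated. *)
Lemma length_le_powers xs s l n :
  length_le (adjoin_seq T [set 0] (s ++ xs)) T l ->
  length_le (adjoin_seq T [set 0] (s ++ [seq x ^+ n | x <- xs])) T (n ^ size xs * l).
Proof.
elim: xs s l => [|x xs IHxs] s l /=; first by rewrite mul1n.
rewrite adjoin_seq_cat_cons => /(length_le_exp (n := n))lel.
rewrite -cat_rcons expnSr -mulnA; apply: IHxs.
rewrite cat_rcons adjoin_seq_cat_cons; apply: lel.
by apply: submod_adjoin_seq; [apply: submodT | apply: submod_zero].
Qed.

(** Write [a] as [b + c * x] with [b] in the new ideal; the difference of the [n]-th powers of [a]
    and [c * x] is a multiple of [b]. *)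
Lemma span_exp s xs x a n : span (s ++ x :: xs : seq R^o) a ->
  span (s ++ x ^+ n :: xs : seq R^o) (a ^+ n).
Proof.
set B : set R^o := span (s ++ x ^+ n :: xs : seq R^o).
move=> sa; have sB : submodule B by apply: submod_span.
have [b [c [Bb ->]]] : exists b c, B b /\ a = b + c * x.
  move: a sa; pose L : set R^o := [set a | exists b c, B b /\ a = b + c * x].
  apply: (span_sub (N := L)).
    apply/submoduleP; split; first by exists 0, 0; rewrite mul0r addr0; split=> //; apply: submod0.
    move=> a _ _ [b [c [Bb ->]]] [b' [c' [Bb' ->]]].
    exists (a *: b + b'), (a * c + c'); split; first exact: submodZD.
    by rewrite /GRing.scale /=; ring.
  move=> y sxy; have [->|neq_yx] := eqVneq y x.
    by exists 0, 1; rewrite add0r mul1r; split=> //; apply: submod0.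
  exists y, 0; rewrite mul0r addr0; split=> //; apply: mem_span.
  by move: sxy; rewrite !(mem_cat, inE) (negPf neq_yx) => /orP[->|/= ->]; rewrite ?orbT.
rewrite -(subrK ((c * x) ^+ n) ((b + c * x) ^+ n)) subrXX addrK.
apply: (submodD sB); first by rewrite mulrC; apply: (submodZ (M := R^o) _ sB).
rewrite exprMn; apply: (submodZ (M := R^o) _ sB); apply: mem_span.
by rewrite mem_cat mem_head orbT.
Qed.

(** At each replacement [x] has to be regular modulo all other entries, that is, the sequence with
    [x] moved last must be regular. The hypothesis about [ys] provides this for all the mixed
    sequences met on the way. *)
Lemma length_ge_powers (xs0 : seq R) (m : set R^o) n xs s l : (0 < n)%N -> submodule m ->
    (forall ys, size ys = size xs0 -> (forall y, y \in ys -> m y) ->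
       (forall x, x \in xs0 -> exists k, span (ys : seq R^o) (x ^+ k)) ->
       regular_seq T [set 0] ys) ->
    size (s ++ xs) = size xs0 -> (forall y, y \in s ++ xs -> m y) ->
    (forall x, x \in xs0 -> exists k, span (s ++ xs : seq R^o) (x ^+ k)) ->
  length_ge (adjoin_seq T [set 0] (s ++ xs)) T l ->
  length_ge (adjoin_seq T [set 0] (s ++ [seq x ^+ n | x <- xs])) T (n ^ size xs * l).
Proof.
move=> n_gt0 sm reg; elim: xs s l => [|x xs IHxs] s l /= sz_sxs msxs nil.
  by rewrite mul1n.
have [_ regx] : regular_seq T [set 0] (s ++ xs) /\
    regular_mod x T (adjoin_seq T [set 0] (s ++ xs)).
  apply/regular_seq_rcons; apply: reg.
  - by rewrite size_rcons -sz_sxs !size_cat /= addnS.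
  - by move=> y; rewrite mem_rcons => sy; apply: msxs; move: sy; rewrite !(mem_cat, inE) orbCA.
  move=> y /nil[k yk]; exists k; apply: span_subset yk => z.
  by rewrite mem_rcons !(mem_cat, inE) orbCA.
have sE := submod_adjoin_seq (s ++ xs) (submodT M) (submod_zero M).
rewrite adjoin_seq_cat_cons => /(length_ge_exp n sE regx) gel.
rewrite -cat_rcons expnSr -mulnA; apply: IHxs.
- by rewrite cat_rcons -sz_sxs !size_cat.
- move=> y; rewrite cat_rcons !(mem_cat, inE) orbCA => /orP[/eqP->|sy].
    rewrite -(prednK n_gt0) exprSr; apply: (submodZ (M := R^o) _ sm).
    by apply: msxs; rewrite mem_cat mem_head orbT.
  by apply: msxs; rewrite !(mem_cat, inE) orbCA sy orbT.
- by move=> y /nil[k yk]; exists (k * n)%N; rewrite cat_rcons exprM; apply: span_exp.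
by rewrite cat_rcons adjoin_seq_cat_cons.
Qed.

End PowerLengths.

(** * Generators and syzygies *)

Section Generators.
Variables (R : comNzRingType) (M : lmodType R).
Implicit Types (N A B : set M) (xs : seq R).

Lemma nakayama_seq xs A B us : (forall x a, x \in xs -> exists c, c * (1 - x * a) = 1) ->
  submodule B -> span us = A -> A `<=` adjoin_seq A B xs -> A `<=` B.
Proof.
move=> + + spanA; elim: xs B => [|x xs IHxs] B rad sB; first by [].
move=> /= AB; have sA : submodule A by rewrite -spanA; apply: submod_span.
have {}AB : A `<=` adjoin B x A.
  apply: IHxs AB => [y a xs_y|]; last exact: submod_adjoin.
  by apply: rad; rewrite inE xs_y orbT.
rewrite -spanA; apply: (nakayama (x := x)) => //.
  by move=> a; apply: rad; rewrite mem_head.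
by move=> u us_u; rewrite spanA; apply: AB; rewrite -spanA; apply: mem_span.
Qed.

(** Elements of [A] are added to ([xs]) [A] one by one; each one outside the span so far lengthens a
    chain, so at most [c] are needed, and Nakayama removes ([xs]) [A]. Padding by zeros makes their
    number exactly [c], so that the rank of the free cover depends on [c] alone. *)
Lemma length_le_generators xs A us c :
    (forall x a, x \in xs -> exists c, c * (1 - x * a) = 1) ->
    span us = A -> length_le (adjoin_seq A [set 0] xs) A c ->
  exists2 vs, size vs = c & span vs = A.
Proof.
move=> rad spanA; have sA : submodule A by rewrite -spanA; apply: submod_span.
set E := adjoin_seq A [set 0] xs => leA.
have sE : submodule E by apply: submod_adjoin_seq => //; apply: submod_zero.
have EA : E `<=` A.
  apply: adjoin_seq_sub => // [_ ->|x u _]; [exact: submod0 | exact: submodZ].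
pose S vs := add_submod E (span vs).
have sS vs : submodule (S vs) by apply: submod_add => //; apply: submod_span.
have ES vs : E `<=` S vs.
  by move=> u Eu; exists u, 0; rewrite addr0; split=> //; apply: submod0; apply: submod_span.
have SA vs : (forall v, v \in vs -> A v) -> S vs `<=` A.
  move=> Avs _ [v [w [/EA Av /(span_sub sA Avs) Aw ->]]]; exact: submodD.
have grow vs : (forall v, v \in vs -> A v) -> ~ A `<=` S vs ->
    exists2 v, A v & length_ge (S vs) (S (v :: vs)) 1.
  move=> Avs /existsNP[v /not_implyP[Av Sv]]; exists v => //; apply: length_ge1 => //.
  split=> [w [e [s [Ee vs_s ->]]]|SS].
    by exists e, s; split=> //; apply: span_subset vs_s => z vs_z; rewrite inE vs_z orbT.
  apply/Sv/SS; exists 0, v; rewrite add0r; split=> //; first exact: submod0.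
  by apply: mem_span; rewrite mem_head.
have gen k : exists vs, [/\ size vs = k, forall v, v \in vs -> A v &
    A `<=` S vs \/ length_ge E (S vs) k].
  elim: k => [|k [vs [sz_vs Avs AS]]]; first by exists [::]; split=> //; right; apply: length_ge0.
  have [AS'|nAS] := pselect (A `<=` S vs).
    exists (0 :: vs); split; first by rewrite /= sz_vs.
      by move=> v; rewrite inE => /orP[/eqP->|/Avs //]; apply: submod0.
    left=> u /AS'[e [s [Ee vs_s ->]]]; exists e, s; split=> //.
    by apply: span_subset vs_s => z vs_z; rewrite inE vs_z orbT.
  case: AS => // gek; have [v Av ge1] := grow vs Avs nAS.
  exists (v :: vs); split; first by rewrite /= sz_vs.
    by move=> w; rewrite inE => /orP[/eqP->|/Avs].
  right; rewrite -addn1; apply: length_ge_cat gek ge1 => //.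
  move=> w [e [s [Ee vs_s ->]]]; exists e, s; split=> //.
  by apply: span_subset vs_s => z vs_z; rewrite inE vs_z orbT.
have [vs [sz_vs Avs AS]] := gen c; exists vs => //.
have {}AS : A `<=` S vs.
  apply: contrapT => nAS; case: AS => // gec; have [v Av ge1] := grow vs Avs nAS.
  suff : (c + 1 <= c)%N by rewrite addn1 ltnn.
  apply: leA; apply: length_ge_sub (subset_refl _) _ (length_ge_cat _ _ gec ge1) => //.
    by apply: SA => w; rewrite inE => /orP[/eqP->|/Avs].
  move=> w [e [s [Ee vs_s ->]]]; exists e, s; split=> //.
  by apply: span_subset vs_s => z vs_z; rewrite inE vs_z orbT.
apply/seteqP; split; first exact: span_sub.
apply: (nakayama_seq rad (submod_span vs) spanA).
apply: subset_trans AS _ => _ [e [s [Ee vs_s ->]]].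
have sX : submodule (adjoin_seq A (span vs) xs).
  by apply: submod_adjoin_seq => //; apply: submod_span.
apply: submodD => //; last exact: sub_adjoin_seq.
apply: (@adjoin_seq_sub _ _ A [set 0] _ xs) Ee => // [_ ->|x u xs_x Au]; first exact: submod0.
by apply: adjoin_seq_scale => //; apply: submod_span.
Qed.

End Generators.

(** * Regularity and length pass to kernels *)

Section Kernels.
Variables (R : comNzRingType) (V M : lmodType R) (f : {linear V -> M}).
Local Notation T := [set: V].
Local Notation A := (range f).
Let K : set V := [set v | f v = 0].

Lemma submod_ker : submodule K.
Proof.
apply/submoduleP; split=> [|a u v]; first exact: raddf0.
by rewrite /K /= linearP => -> ->; rewrite scaler0 addr0.
Qed.

(** As [NV] maps onto [NA], the quotients of [K], [V] and the range form a short exact sequence. It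
    stays exact modulo [x] because [x] is regular on the last term, and the induction continues. *)
Lemma kernel_regular xs NV NA : submodule NV -> submodule NA ->
    (forall v, NV v -> NA (f v)) -> (forall a, NA a -> exists2 v, NV v & f v = a) ->
    regular_seq T NV xs -> regular_seq A NA xs ->
  regular_seq K (NV `&` K) xs /\
  adjoin_seq T NV xs `&` K = adjoin_seq K (NV `&` K) xs.
Proof.
elim: xs NV NA => [|x xs IHxs] NV NA //= sV sA fV fA [regV regsV] [regA regsA].
have -> : adjoin (NV `&` K) x K = adjoin NV x T `&` K.
  apply/seteqP; split=> [_ [v [w [[Nv Kv] Kw ->]]]|_ [[v [w [Nv _ ->]]] Kvw]].
    split; first by exists v, w.
    by rewrite /K /= linearD linearZ /= Kv Kw scaler0 addr0.
  (* Regularity puts [f w] in [NA]; a lift [v'] of it to [NV] corrects [w] to the element [w - v']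
     of [K]. *)
  have [|v' Nv' fv'] := fA (f w).
    apply: regA; first by exists w.
    have -> : x *: f w = - f v.
      by apply/eqP; rewrite -addr_eq0 addrC -linearZ -linearD Kvw.
    by apply: submodN => //; apply: fV.
  exists (v + x *: v'), (w - v'); split; last by rewrite scalerBr addrA addrAC addrK.
    split; first by apply: submodD => //; apply: submodZ.
    by rewrite /K /= linearD linearZ /= fv' -linearZ -linearD.
  by rewrite /K /= linearB /= fv' subrr.
have sfV : submodule A.
  apply/submoduleP; split; first by exists 0; rewrite ?linear0.
  by move=> a _ _ [u _ <-] [v _ <-]; exists (a *: u + v); rewrite ?linearP.
have sVx := submod_adjoin x sV (submodT V).
have [||reg ->] := IHxs _ _ sVx (submod_adjoin x sA sfV) _ _ regsV regsA.
- move=> _ [v [w [Nv _ ->]]]; exists (f v), (f w).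
  by split; [exact: fV | by exists w | by rewrite linearD linearZ].
- move=> _ [v [_ [/fA[v' Nv' <-] [w _ <-] ->]]].
  by exists (v' + x *: w); rewrite ?linearD ?linearZ //; exists v', w.
by split=> //; split=> // u Ku [Nxu _]; split=> //; apply: regV.
Qed.

(** Since ([xs]) [V] meets [K] in ([xs]) [K], the quotient of [K] embeds in that of [V]. *)
Lemma kernel_length_le xs c : regular_seq T [set 0] xs -> regular_seq A [set 0] xs ->
  length_le (adjoin_seq T [set 0] xs) T c ->
  regular_seq K [set 0] xs /\ length_le (adjoin_seq K [set 0] xs) K c.
Proof.
move=> regT regA leT; have sK := submod_ker.
have IK : [set 0] `&` K = [set 0].
  by apply/seteqP; split=> [u []//|_ ->]; split=> //; apply: submod0.
have [|a ->|] := kernel_regular (submod_zero V) (submod_zero M) _ _ regT regA.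
- by move=> _ ->; rewrite raddf0.
- by exists 0; rewrite ?raddf0.
rewrite IK => regK EK; split=> // k gek; apply: leT.
have sE : submodule (adjoin_seq T [set 0] xs).
  by apply: submod_adjoin_seq; [exact: submodT | exact: submod_zero].
apply: (length_ge_map (phi := fun L => add_submod L (adjoin_seq T [set 0] xs))) gek.
- move=> L [sL _ _]; split=> //; first exact: submod_add.
  by move=> u Eu; exists 0, u; rewrite add0r; split=> //; apply: submod0.
- by move=> L L' _ _ LL' _ [v [w [/LL' Lv Ew ->]]]; exists v, w.
move=> L L' [sL EL LK] [sL' _ LK'] LL' ll u L'u.
have [|v [w [Lv Ew def_u]]] := ll u.
  by exists u, 0; rewrite addr0; split=> //; apply: submod0.
rewrite def_u; apply: submodD => //; apply: EL; rewrite -EK; split=> //.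
have -> : w = u - v by rewrite def_u addrC addKr.
by apply: submodB => //; [apply: LK' | apply: LK].
Qed.

End Kernels.

(** * Finite free modules *)

Section FreeModules.
Variables (R : comNzRingType) (xs : seq R) (c : nat).
Implicit Types (N : set R^o).
Local Notation V := 'rV[R]_c.

Definition entrywise N : set V := [set v | forall j, N (v 0 j)].

Lemma entrywise_adjoin N x :
  entrywise (adjoin N x [set: R^o]) = adjoin (entrywise N) x [set: V].
Proof.
apply/seteqP; split=> [v Nv|_ [v [w [Nv _ ->]]] j]; last first.
  by exists (v 0 j), (w 0 j); rewrite !mxE.
have /choice[g gP] : forall j, exists g : R * R, N g.1 /\ v 0 j = g.1 + x * g.2.
  by move=> j; have [a [b [Na _ def_v]]] := Nv j; exists (a, b).
exists (\row_j (g j).1), (\row_j (g j).2); split=> //.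
  by move=> j; rewrite mxE; case: (gP j).
by apply/rowP=> j; rewrite !mxE; case: (gP j).
Qed.

Lemma entrywise0 : entrywise [set 0] = [set 0].
Proof.
apply/seteqP; split=> [v v0|_ -> j]; last by rewrite mxE.
by apply/rowP => j; rewrite mxE; apply: v0.
Qed.

Lemma entrywise_adjoin_seq N : entrywise (adjoin_seq [set: R^o] N xs) =
  adjoin_seq [set: V] (entrywise N) xs.
Proof. by elim: xs N => //= x s IHs N; rewrite IHs entrywise_adjoin. Qed.

Lemma free_regular N : regular_seq [set: R^o] N xs -> regular_seq [set: V] (entrywise N) xs.
Proof.
elim: xs N => //= x s IHs N [regx regs]; split; last by rewrite -entrywise_adjoin; apply: IHs.
by move=> v _ Nv j; apply: regx => //; have := Nv j; rewrite mxE.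
Qed.

Lemma free_finitely_generated : finitely_generated V.
Proof.
exists [seq delta_mx 0 j | j <- enum 'I_c]; apply/seteqP; split=> // v _.
have sS := submod_span [seq delta_mx 0 j : V | j <- enum 'I_c].
rewrite (row_sum_delta v); apply: submod_sum => // j _; apply: submodZ => //.
by apply: mem_span; apply: map_f; rewrite mem_enum.
Qed.

Lemma free_length_le l : length_le (adjoin_seq [set: R^o] [set 0] xs) [set: R^o] l ->
  length_le (adjoin_seq [set: V] [set 0] xs) [set: V] (c * l).
Proof.
set E := adjoin_seq [set: R^o] _ _ => leE.
have sE : submodule E by apply: submod_adjoin_seq; [exact: submodT | exact: submod_zero].
rewrite -entrywise0 -entrywise_adjoin_seq -/E.
(* A filtration from the vectors with all entries in [E] to all of [V]. Coordinate [k] identifies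
   the layer from [F k] to [F k.+1] with [R] / [E]. *)
pose F k : set V := [set v | forall j : 'I_c, (k <= j)%N -> E (v 0 j)].
have sF k : submodule (F k).
  apply/submoduleP; split=> [j _|a u v Fu Fv j le_kj]; rewrite !mxE; first exact: (submod0 sE).
  by have := submodZD a sE (Fu j le_kj) (Fv j le_kj).
have -> : entrywise E = F 0%N by apply/seteqP; split=> v Ev j; have := Ev j; auto.
have -> : [set: V] = F c.
  by apply/seteqP; split=> // v _ j; rewrite leqNgt ltn_ord.
have FS i k : (i <= k)%N -> F i `<=` F k.
  by move=> le_ik v Fv j le_kj; apply: Fv; apply: leq_trans le_kj.
suff leF k : (k <= c)%N -> length_le (F 0%N) (F k) (k * l) by exact: leF.
elim: k => [_|k IHk lt_kc].
  move=> k [C [PC ltC]]; case: k PC ltC => // k PC ltC.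
  have [_] := ltC 0%N isT; case; have [_ + _] := PC 0%N isT.
  by have [_ _ CF] := PC 1%N isT => FC u /CF/FC.
rewrite mulSn addnC; apply: (@length_le_add _ _ _ (F k)) => //; try exact: FS.
  by apply: IHk; apply: ltnW.
move=> n gen; apply: leE; pose j := Ordinal lt_kc.
pose phi (L : set V) : set R^o := [set a | exists2 v, L v & v 0 j = a].
apply: (length_ge_map (phi := phi)) gen.
- move=> L [sL FL LF]; split=> // [|a Ea].
    apply/submoduleP; split; first by exists 0; rewrite ?mxE //; apply: submod0.
    move=> a _ _ [u Lu <-] [v Lv <-]; exists (a *: u + v); first exact: submodZD.
    by rewrite !mxE.
  exists (a *: delta_mx 0 j); last by rewrite !mxE !eqxx mulr1.
  apply: FL => i le_ki; rewrite !mxE eqxx /=; case: eqP => [_|_].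
    by rewrite mulr1.
  by rewrite mulr0; apply: (submod0 sE).
- by move=> L L' _ _ LL' _ [v /LL' Lv <-]; exists v.
move=> L L' [sL FL LF] [sL' _ LF'] LL' ll u L'u.
have [|v Lv eq_vu] := ll (u 0 j); first by exists u.
rewrite -(subrK v u); apply: submodD => //; apply: FL => i le_ki.
have Fuv : F k.+1 (u - v) by apply: (submodB (sF k.+1)); [apply: LF' | apply: LF].
have [eq_ij|neq_ij] := eqVneq i j.
  by rewrite eq_ij !mxE eq_vu subrr; apply: (submod0 sE).
by apply: Fuv; rewrite ltn_neqAle le_ki andbT eq_sym.
Qed.

End FreeModules.

(** * Ideal powers and polynomial growth *)

Section IdealPowers.
Variable R : comNzRingType.
Implicit Types (m J : set R^o) (xs : seq R).

Lemma mulI J a b : submodule J -> J b -> J (a * b).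
Proof. by move=> sJ; apply: (submodZ (M := R^o)). Qed.

(** Pigeonhole: when a product of more than [size xs * n] linear combinations of [xs] is expanded,
    each monomial contains some entry to the power [n]. *)
Lemma prod_in_powers xs n J : submodule J -> (forall x, x \in xs -> J (x ^+ n)) ->
  prod_in (span (xs : seq R^o)) (size xs * n).+1 J.
Proof.
move=> sJ; elim: xs => [_|x xs IHxs Jxs] s sz_s Ss.
  case: s sz_s Ss => // a s _ /(_ a (mem_head _ _)); rewrite span_nil => ->.
  by rewrite big_cons mul0r; apply: submod0.
have {}IHxs : prod_in (span (xs : seq R^o)) (size xs * n).+1 J.
  by apply: IHxs => y xs_y; apply: Jxs; rewrite inE xs_y orbT.
(* A partly expanded product: [s] holds the factors still to be split, [s'] the parts in the span of
   the tail, and [b] counts the factors [x]. *)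
suff prodJ s' b : (forall a, a \in s' -> span (xs : seq R^o) a) ->
    ((size (x :: xs) * n).+1 <= size s + size s' + b)%N ->
    J (\prod_(a <- s) a * (\prod_(a <- s') a * x ^+ b)).
  have := prodJ [::] 0%N; rewrite big_nil !mulr1; apply => //.
  by rewrite /= !addn0.
elim: s s' b Ss {sz_s} => [|e s IHs] s' b Ss Ss' le_b.
  rewrite big_nil mul1r; have [le_nb|lt_bn] := leqP n b.
    rewrite -(subnK le_nb) exprD !mulrA; apply: mulI => //.
    by apply: Jxs; rewrite mem_head.
  rewrite mulrC; apply: mulI => //; apply: IHxs => //.
  by move: le_b => /=; rewrite mulSn; lia.
have /span_cons[c [j [xs_j ->]]] := Ss e (mem_head _ _).
rewrite big_cons.
have -> : (c *: (x : R^o) + j) * \prod_(a <- s) a * (\prod_(a <- s') a * x ^+ b) =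
   c *: (\prod_(a <- s) a * (\prod_(a <- s') a * x ^+ b.+1) : R^o) +
   \prod_(a <- s) a * (\prod_(a <- j :: s') a * x ^+ b).
  by rewrite big_cons exprS /GRing.scale /=; ring.
have Ss1 a : a \in s -> span (x :: xs : seq R^o) a.
  by move=> sa; apply: Ss; rewrite inE sa orbT.
apply: submodZD => //; apply: IHs => //; rewrite /= in le_b *; try lia.
by move=> a; rewrite inE => /orP[/eqP->|/Ss'].
Qed.

(** The factors are grouped in [t] blocks of [k], each with product in [J]; the surplus goes into
    [c]. *)
Lemma prod_in_mul m k J t J' : submodule J' -> prod_in m k J -> prod_in J t J' ->
  prod_in m (k * t) J'.
Proof.
move=> sJ' mJ JJ' s sz_s ms.
have [s' [sz_s' Js' [c ->]]] : exists s', [/\ size s' = t, forall a, a \in s' -> J a &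
    exists c, \prod_(a <- s) a = c * \prod_(a <- s') a].
  elim: t s sz_s ms {JJ'} => [|t IHt] s sz_s ms.
    by exists [::]; split=> //; exists (\prod_(a <- s) a); rewrite big_nil mulr1.
  have [||s' [sz_s' Js' [c def_c]]] := IHt (drop k s).
  - by rewrite size_drop; move: sz_s; rewrite mulnS; lia.
  - by move=> a /mem_drop/ms.
  exists (\prod_(a <- take k s) a :: s'); split=> /=; first by rewrite sz_s'.
    move=> a; rewrite inE => /orP[/eqP->|/Js' //]; apply: mJ; last by move=> b /mem_take/ms.
    by rewrite size_take; case: ltnP => //; move: sz_s; rewrite mulnS; lia.
  exists c; rewrite -{1}(cat_take_drop k s) big_cat /= def_c big_cons.
  by rewrite mulrCA.
by apply: mulI => //; apply: JJ'; rewrite ?sz_s'.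
Qed.

Lemma prod_in_exp m k J a : prod_in m k J -> m a -> J (a ^+ k).
Proof.
move=> mJ ma; have := mJ (nseq k a); rewrite big_nseq size_nseq iter_mulr_1.
by apply=> // b /nseqP[-> _].
Qed.

End IdealPowers.

Section ModulePowers.
Variables (R : comNzRingType) (M : lmodType R) (m : set R).
Implicit Types (N L : set M) (xs : seq R).

Lemma ideal_smul_sub N L : submodule L ->
  (forall a u, m a -> N u -> L (a *: u)) -> ideal_smul m N `<=` L.
Proof.
move=> sL mNL _ [s [smN ->]]; apply: submod_sum => // p /smN[mp Np].
exact: mNL.
Qed.

Lemma ideal_pow_sub n N : submodule N ->
    (forall s : seq R, size s = n -> (forall a, a \in s -> m a) ->
       forall u, N (\prod_(a <- s) a *: u)) ->
  ideal_pow_smul m n `<=` N.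
Proof.
elim: n N => [|n IHn] N sN mN.
  by move=> u _; have := mN [::] erefl; rewrite big_nil -[u in N u]scale1r; apply.
apply: ideal_smul_sub => // a u ma.
pose L : set M := [set v | N (a *: v)].
have sL : submodule L.
  apply/submoduleP; split=> [|b v w Lv Lw]; rewrite /L /=.
    by rewrite scaler0; apply: submod0.
  by rewrite scalerDr scalerA mulrC -scalerA; apply: submodZD.
move=> nu; apply: (IHn L sL) nu => s sz_s ms v; rewrite /L /= scalerA.
have := mN (a :: s); rewrite big_cons; apply; first by rewrite /= sz_s.
by move=> b; rewrite inE => /orP[/eqP->|/ms].
Qed.

Lemma ideal_smul_mem N a u : m a -> N u -> ideal_smul m N (a *: u).
Proof.
move=> ma Nu; exists [:: (a, u)]; rewrite big_seq1; split=> // p.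
by rewrite inE => /eqP->.
Qed.

Lemma ideal_pow_mem n a (u : M) : m a -> ideal_pow_smul m n (a ^+ n *: u).
Proof.
move=> ma; elim: n u => [|n IHn] u //.
by rewrite exprS -scalerA; exact: (ideal_smul_mem ma (IHn u)).
Qed.

Lemma submod_ideal_smul N : submodule (m : set R^o) -> submodule (ideal_smul m N).
Proof.
move=> sm; apply/submoduleP; split.
  by exists [::]; rewrite big_nil.
move=> a _ _ [s [sP ->]] [t [tP ->]].
exists ([seq (a * p.1, p.2) | p <- s] ++ t); split.
  move=> p; rewrite mem_cat => /orP[/mapP[q /sP[mq Nq] ->]|/tP //]; split=> //=.
  exact: mulI.
rewrite big_cat big_map scaler_sumr /=; congr (_ + _).
by apply: eq_bigr => p _; rewrite scalerA.
Qed.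

Lemma submod_ideal_pow n : submodule (m : set R^o) ->
  submodule (ideal_pow_smul m n : set M).
Proof.
by case: n => [|n] sm; [exact: submodT | exact: submod_ideal_smul].
Qed.

Lemma adjoin_powers_sub xs n : submodule (m : set R^o) -> (forall x, x \in xs -> m x) ->
  adjoin_seq [set: M] [set 0] [seq x ^+ n | x <- xs] `<=` ideal_pow_smul m n.
Proof.
move=> sm mxs; have sI := submod_ideal_pow n sm.
apply: adjoin_seq_sub => // [_ ->|_ u /mapP[x xs_x ->] _]; first exact: submod0.
by apply: ideal_pow_mem; apply: mxs.
Qed.

(** With r = [size xs], a product of k(r+1)n elements of [m] lies in ([xs])^((r+1)n), and (r+1)n is
    at least rn + 1 for positive [n], as the pigeonhole bound requires. *)
Lemma sub_adjoin_powers xs k n : (0 < n)%N ->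
    prod_in m k (span (xs : seq R^o)) ->
  ideal_pow_smul m (k * (size xs).+1 * n) `<=`
    adjoin_seq [set: M] [set 0] [seq x ^+ n | x <- xs].
Proof.
move=> n_gt0 nil; set E := adjoin_seq _ _ _.
have sE : submodule E by apply: submod_adjoin_seq; [exact: submodT | exact: submod_zero].
have sQ := submod_quotient_annihilator sE.
apply: ideal_pow_sub => // s sz_s ms u.
have powQ x : x \in xs -> quotient_annihilator E (x ^+ n).
  move=> xs_x v; apply: adjoin_seq_scale => //; [exact: submodT|exact: submod_zero|].
  exact: map_f.
apply: (prod_in_mul sQ nil (prod_in_powers sQ powQ)) => //.
by rewrite sz_s -mulnA leq_mul2l mulSn; apply/orP; right; lia.
Qed.

End ModulePowers.

(** * Growth of rational polynomials *)

Section PolynomialGrowth.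
Import Order.TTheory Num.Theory.

Lemma poly_eventually_gt (Q : {poly rat}) : 0 < lead_coef Q ->
  exists2 e : rat, 0 < e & exists n0, forall n, (n0 <= n)%N -> e <= Q.[n%:R].
Proof.
elim/poly_ind: Q => [|q a IHq]; first by rewrite lead_coef0 ltxx.
have [->|q0] := eqVneq q 0.
  rewrite mul0r add0r lead_coefC => a_gt0; exists a => //.
  by exists 0%N => n _; rewrite hornerC.
have -> : lead_coef (q * 'X + a%:P) = lead_coef q.
  rewrite lead_coefDl ?lead_coefMX // size_mulX // size_polyC.
  by case: (a == 0); rewrite ?ltnS //= size_poly_gt0.
move=> /IHq[e e_gt0 [n0 n0P]]; exists e => //.
(* From here on [e] [n] exceeds [e] + |[a]|, so [q] bounded below by [e] gives [n] [q]([n]) + [a] at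
   least [e]. *)
pose b := Num.bound ((e + `|a|) / e).
exists (maxn n0 b) => n; rewrite geq_max => /andP[/n0P le_e le_bn].
rewrite hornerD hornerMX hornerC.
have : (e + `|a|) / e < n%:R.
  apply: lt_le_trans (archi_boundP _) _; last by rewrite ler_nat.
  by rewrite divr_ge0 ?addr_ge0 // ltW.
rewrite ltr_pdivrMr // => lt_n.
have le_mul : e * n%:R <= q.[n%:R] * n%:R by rewrite ler_wpM2r.
have := lerNnormlW (lexx `|a|).
lra.
Qed.

Lemma lead_coef_ge0 (Q : {poly rat}) n0 :
  (forall n, (n0 <= n)%N -> 0 <= Q.[n%:R]) -> 0 <= lead_coef Q.
Proof.
move=> Qge0; rewrite leNgt; apply/negP => ltQ.
have [|e e_gt0 [n1 n1P]] := @poly_eventually_gt (- Q); first by rewrite lead_coefN oppr_gt0.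
have := n1P (maxn n0 n1) (leq_maxr _ _); have := Qge0 (maxn n0 n1) (leq_maxl _ _).
rewrite hornerN; lra.
Qed.

(** The upper bound forces the degree of [P] to be at most [d]; the lower bound then compares
    coefficients in degree [d]. *)
Lemma growth_bound (P : {poly rat}) (d K n0 : nat) (A l : rat) : (0 < K)%N ->
    (forall n, (n0 <= n)%N -> 0 <= P.[n%:R] <= A * n%:R ^+ d) ->
    (forall n, (n0 <= n)%N -> l * n%:R ^+ d <= P.[(K * n)%:R]) ->
  l <= K%:R ^+ d * P`_d.
Proof.
move=> K_gt0 leP geP.
have szP : (size P <= d.+1)%N.
  rewrite leqNgt; apply/negP => lt_dP.
  have szX : (size (A *: 'X^d : {poly rat}) < size P)%N.
    by apply: leq_ltn_trans (size_scale_leq _ _) _; rewrite size_polyXn.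
  have : 0 <= lead_coef (- P + A *: 'X^d).
    apply: (@lead_coef_ge0 _ n0) => n /leP/andP[_].
    by rewrite hornerD hornerN hornerZ hornerXn; lra.
  rewrite lead_coefDl ?size_polyN // lead_coefN.
  have : P != 0 by rewrite -size_poly_gt0; apply: leq_trans lt_dP.
  rewrite -lead_coef_eq0.
  have : 0 <= lead_coef P by apply: (@lead_coef_ge0 _ n0) => n /leP/andP[].
  by move=> ge0 /eqP ne0 le0; apply: ne0; lra.
(* [Q] is P(KX) - l X^d, which is eventually nonnegative. *)
pose Q := \poly_(i < d.+1) (K%:R ^+ i * P`_i) - l *: 'X^d.
have coefQ i : Q`_i = (if (i < d.+1)%N then K%:R ^+ i * P`_i else 0) - l * (i == d)%:R.
  by rewrite coefB coef_poly coefZ coefXn.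
have szQ : (size Q <= d.+1)%N.
  by apply/leq_sizeP => i lt_di; rewrite coefQ ltnNge lt_di gtn_eqF // mulr0 subr0.
have : 0 <= lead_coef Q.
  apply: (@lead_coef_ge0 _ n0) => n /geP.
  rewrite hornerD hornerN hornerZ hornerXn horner_poly (horner_coef_wide _ szP).
  rewrite -subr_ge0 => le_l; congr (_ <= _ - _): le_l; apply: eq_bigr => i _.
  by rewrite natrM exprMn mulrA [_ * P`_i]mulrC.
(* If [Q] has degree below [d], its vanishing coefficient in degree [d] gives equality. *)
have [ltQ|geQ] := ltnP d (size Q); last first.
  by have /eqP := coefQ d; rewrite nth_default // ltnSn eqxx mulr1 eq_sym subr_eq0 => /eqP ->.
have -> : lead_coef Q = Q`_d by rewrite lead_coefE; congr (_`_ _); apply/eqP; rewrite eqn_leq; lia.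
by rewrite coefQ ltnSn eqxx mulr1 subr_ge0.
Qed.

End PolynomialGrowth.

(** * Multiplicity bounds the length modulo a parameter sequence *)

Section CohenMacaulayModules.
Variables (R : comNzRingType).

Lemma ideal_smul_span (M : lmodType R) (xs : seq R) :
  ideal_smul (span (xs : seq R^o)) [set: M] = adjoin_seq [set: M] [set 0] xs.
Proof.
have sE := submod_adjoin_seq xs (submodT M) (submod_zero M).
have sI := submod_ideal_smul [set: M] (submod_span (xs : seq R^o)).
apply/seteqP; split.
  apply: ideal_smul_sub => // a u xs_a _.
  have sQ := submod_quotient_annihilator sE.
  suff : quotient_annihilator (adjoin_seq [set: M] [set 0] xs) a by apply.
  apply: (span_sub sQ) xs_a => x xs_x v.
  by apply: adjoin_seq_scale => //; [exact: submodT | exact: submod_zero].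
apply: adjoin_seq_sub => // [_ ->|x u xs_x _]; first exact: submod0.
by apply: ideal_smul_mem => //; apply: mem_span.
Qed.

Lemma regular_seq_take (M : lmodType R) (xs : seq R) (A N : set M) :
    (forall i, (i < size xs)%N -> regular_mod xs`_i A (adjoin_seq A N (take i xs))) ->
  regular_seq A N xs.
Proof.
elim: xs N => //= x xs IHxs N reg; split; first exact: (reg 0%N).
by apply: IHxs => i; apply: (reg i.+1).
Qed.

Lemma regular_sequence_seq (M : lmodType R) (xs : seq R) : regular_sequence M xs ->
  regular_seq [set: M] [set 0] xs /\ adjoin_seq [set: M] [set 0] xs <> setT.
Proof.
case=> reg proper; rewrite -ideal_smul_span; split=> //.
apply: regular_seq_take => i lt_i u _; rewrite -ideal_smul_span; exact: reg.
Qed.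

Lemma is_max_uniq (P : nat -> Prop) a b : is_max P a -> is_max P b -> a = b.
Proof. by move=> [Pa lea] [Pb leb]; apply/eqP; rewrite eqn_leq leb ?lea. Qed.

Lemma has_chain_sub (T : Type) (P Q : set (set T)) k : P `<=` Q -> has_chain P k -> has_chain Q k.
Proof. by move=> PQ [C [PC ltC]]; exists C; split=> // i /PC/PQ. Qed.

Lemma has_chain_length (M : lmodType R) (N : set M) k :
  has_chain [set L | submodule L /\ N `<=` L] k <-> length_ge N setT k.
Proof. by split; apply: has_chain_sub => L; [case=> sL NL; split | case]. Qed.

Lemma quotient_length_le (M : lmodType R) (N : set M) l :
  quotient_length N l -> length_le N setT l.
Proof. by case=> _ lel k /has_chain_length; apply: lel. Qed.

Variables (m : set R) (noethR : noetherian R) (localR : local_ring m).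

(** One of the two parts of 1 is a unit, so its summand is everything. This makes the multiplicity
    bound applicable to [R] itself. *)
Lemma local_indecomposable : indecomposable R^o.
Proof.
split; first by exists 1; apply: oner_neq0.
move=> N L sN sL NL0 NLT; have sM := submod_max localR.
have unit_full (I : set R^o) a : submodule I -> I a -> ~ m a -> I = setT.
  move=> sI Ia /(unit_notin_max noethR localR)[b ba1].
  apply/seteqP; split=> // c _; rewrite -[c]mulr1 -ba1.
  by do 2!apply: mulI => //.
have [a [b [Na Lb ab1]]] := NLT 1.
have [ma|/(unit_full N a sN Na) NT] := pselect (m a); last first.
  by right; rewrite -NL0 NT setTI.
have [mb|/(unit_full L b sL Lb) LT] := pselect (m b); last first.
  by left; rewrite -NL0 LT setIT.
by case: (max1 localR); rewrite ab1; apply: (submodD sM).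
Qed.

Lemma prime_zero (p : set R) : prime_ideal p -> p 0.
Proof. by case/prime_idealP=> sp _ _; exact: (submod0 sp). Qed.

(** A prime containing [xs] other than [m] would end a chain of length [d], and adding [m] would
    exceed the dimension. So [m] is the only prime above ([xs]). *)
Lemma parameters_nilpotent d xs : ring_dim R d -> size xs = d ->
    (forall x, x \in xs -> m x) -> regular_seq [set: R^o] [set 0] xs ->
  exists2 k, (0 < k)%N & prod_in m k (span (xs : seq R^o)).
Proof.
move=> [_ dimR] sz_xs mxs reg; have sS := submod_span (xs : seq R^o).
have [||k nil] := @max_nilpotent R noethR m localR (span (xs : seq R^o)) => //; last first.
  by exists k.+1 => // s /ltnW; apply: nil.
move=> p prp xs_p; apply: contrapT => neq_pm.
have pm : p `<=` m.
  by case/prime_idealP: prp => sp p1 _; apply: (proper_sub_max noethR localR sp p1).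
have [|C [Cd prC ltC]] := @regular_seq_chain R R^o xs [set 0] p noethR (submod_zero _) reg prp.
  move=> a /(_ 1) Ea; apply: xs_p; rewrite -[a]mulr1.
  apply: (adjoin_seq_sub (xs := xs) (A := [set: R^o]) sS _ _ Ea) => [_ ->|x u xs_x _].
    exact: submod0.
  by rewrite /GRing.scale /= mulrC; apply: mulI => //; apply: mem_span.
rewrite sz_xs in Cd prC ltC.
have : (d.+1 <= d)%N; last by rewrite ltnn.
apply: dimR; exists (fun i => if (i <= d)%N then C i else m); split=> i le_i.
  have prm := prime_max noethR localR.
  by case: leqP => [/prC[prCi _]|_]; split=> // _ ->; apply: prime_zero.
rewrite -ltnS le_i; case: ltnP => [lt_id|le_di]; first exact: ltC.
have -> : i = d by apply/eqP; rewrite eqn_leq -ltnS le_i.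
by rewrite Cd; split=> // mp; apply: neq_pm; apply/seteqP.
Qed.

(** A regular sequence of length [d] yields a chain of [d] steps of primes above the annihilator,
    ending in [m]. Thus the coefficient defining the multiplicity is the one in degree dim [R]. *)
Lemma module_dim_maximal (M : lmodType R) d d' : ring_dim R d -> depth m M d ->
  module_dim M d' -> d' = d.
Proof.
move=> [_ dimR] [[ys [sz_ys mys /regular_sequence_seq[reg proper]]] _] [dimM maxM].
apply/eqP; rewrite eqn_leq; apply/andP; split.
  apply: dimR; apply: has_chain_sub dimM => p [prp Mp]; split=> // _ ->.
  exact: prime_zero.
have sE := submod_adjoin_seq ys (submodT M) (submod_zero M).
have [|C [_ prC ltC]] := regular_seq_chain noethR (submod_zero M) reg (prime_max noethR localR).
  apply: (proper_sub_max noethR localR) => [|E1]; first exact: submod_quotient_annihilator.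
  by apply: proper; apply/seteqP; split=> // u _; rewrite -[u]scale1r.
rewrite sz_ys in prC ltC; apply: maxM; exists C; split=> // i /prC[].
Qed.

Lemma maximal_CM_regular (M : lmodType R) d xs k : ring_dim R d -> maximal_CM m M ->
    size xs = d -> (forall x, x \in xs -> m x) -> prod_in m k (span (xs : seq R^o)) ->
  regular_seq [set: M] [set 0] xs.
Proof.
move=> dimR [fgM [d1 dimR1]]; rewrite -(is_max_uniq dimR dimR1).
move=> [[ys [sz_ys mys /regular_sequence_seq[regys _]]] _] sz_xs mxs nil.
apply: parameters_regular regys _ _ => //; try by rewrite sz_xs.
- by move=> x a /mxs; apply: max_radical.
- exact: submod_zero.
by move=> y /mys my; exists k; apply: prod_in_exp nil my.
Qed.

(** The quotients by powers of [xs] are squeezed between quotients by powers of [m], whose lengths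
    [P] computes. *)
Lemma maximal_CM_length_le (M : lmodType R) d xs k e : ring_dim R d -> maximal_CM m M ->
    size xs = d -> (forall x, x \in xs -> m x) -> (0 < k)%N ->
    prod_in m k (span (xs : seq R^o)) -> multiplicity m M e ->
  length_le (adjoin_seq [set: M] [set 0] xs) setT ((k * d.+1) ^ d * e).
Proof.
move=> dimR [fgM [d1 dimR1]]; rewrite -(is_max_uniq dimR dimR1) {d1 dimR1}.
move=> depthM sz_xs mxs k_gt0 nil [d' [P [dimM [n0 Pn0] eP]]].
move: eP; rewrite (module_dim_maximal dimR depthM dimM) {d' dimM} => eP.
have [[ys [sz_ys mys /regular_sequence_seq[regys _]]] _] := depthM.
have sm := submod_max localR; set K := (k * d.+1)%N.
have K_gt0 : (0 < K)%N by rewrite muln_gt0 k_gt0.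
pose E n := adjoin_seq [set: M] [set 0] [seq x ^+ n | x <- xs].
have E_sub n : E n `<=` ideal_pow_smul m n by apply: adjoin_powers_sub.
have sub_E n : (0 < n)%N -> ideal_pow_smul m (K * n) `<=` E n.
  by move=> n_gt0; rewrite /K -sz_xs; apply: sub_adjoin_powers.
have E1 : adjoin_seq [set: M] [set 0] xs = E 1%N.
  by rewrite /E (eq_map (g := id)) ?map_id.
pose n1 := maxn n0 1.
have n1P n : (n1 <= n)%N -> (n0 <= n)%N /\ (0 < n)%N.
  by rewrite geq_max => /andP[].
have le_K n : (n <= K * n)%N by rewrite leq_pmull.
have [n1n0 n1_gt0] := n1P n1 (leqnn _).
(* A first, non-uniform bound, from a power of [m] whose product with [M] lies in ([xs]) [M]. It
   serves only to bound the degree of [P]. *)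
have [A leA] : exists A, length_le (E 1%N) setT A.
  have [l /quotient_length_le lel _] := Pn0 (K * n1)%N (leq_trans n1n0 (le_K _)).
  exists l; apply: length_le_sub lel => //; apply: subset_trans (sub_E _ n1_gt0) _.
  rewrite -E1; apply: adjoin_seq_sub => [|_ ->|_ u /mapP[x xs_x ->] _].
  - exact: submod_adjoin_seq (submodT M) (submod_zero M).
  - by apply: submod0; apply: submod_adjoin_seq (submodT M) (submod_zero M).
  rewrite -(prednK n1_gt0) exprS -scalerA.
  by apply: adjoin_seq_scale => //; [exact: submodT | exact: submod_zero].
rewrite E1 => l gel.
have upper n : (n1 <= n)%N -> 0 <= P.[n%:R] <= A%:R * n%:R ^+ d.
  move=> /n1P[le_n n_gt0]; have [l' [gel' _] ->] := Pn0 n le_n.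
  rewrite ler0n /= -natrX -natrM ler_nat mulnC -sz_xs.
  have := @length_le_powers R M xs [::] A n; rewrite /= E1 => /(_ leA); apply.
  by move/has_chain_length: gel'; apply: length_ge_sub (E_sub n) _.
have lower n : (n1 <= n)%N -> l%:R * n%:R ^+ d <= P.[(K * n)%:R].
  move=> /n1P[le_n n_gt0].
  have [l' /quotient_length_le lel' ->] := Pn0 (K * n)%N (leq_trans le_n (le_K n)).
  rewrite -natrX -natrM ler_nat mulnC -{1}sz_xs; apply: lel'.
  apply: (length_ge_sub (sub_E n n_gt0) (@subset_refl _ setT)).
  have := @length_ge_powers R M ys m n xs [::] l n_gt0 sm; rewrite /= -E1 in gel *; apply.
  - move=> zs sz_zs mzs nilys.
    apply: parameters_regular regys _ _ => //.
      by move=> x a /mzs; apply: max_radical.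
    exact: submod_zero.
  - by rewrite sz_xs.
  - by [].
  - by move=> y /mys my; exists k; apply: prod_in_exp nil my.
  by [].
have leP := growth_bound K_gt0 upper lower.
(* Nonnegativity allows the coefficient to be replaced by its multiple by d!, which is [e]. *)
have P_ge0 : 0 <= P`_d.
  have : 0 <= K%:R ^+ d * P`_d by apply: le_trans leP; apply: ler0n.
  by rewrite pmulr_rge0 // exprn_gt0 ?ltr0n.
rewrite -(ler_nat rat) natrM natrX eP; apply: le_trans leP _.
rewrite ler_pM2l ?exprn_gt0 ?ltr0n //; apply: ler_peMl => //.
by rewrite ler1n fact_gt0.
Qed.

End CohenMacaulayModules.

(** * Resolutions and the tautological complex *)

Section RowMap.
Variables (R : comNzRingType) (M : lmodType R) (c : nat) (us : seq M).

Definition row_map (v : 'rV[R]_c) : M := \sum_j v 0 j *: us`_j.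

Lemma row_map_linear : linear row_map.
Proof.
move=> a u v; rewrite /row_map scaler_sumr -big_split; apply: eq_bigr => j _.
by rewrite !mxE scalerDl scalerA.
Qed.

HB.instance Definition _ :=
  GRing.isLinear.Build R 'rV[R]_c M *:%R row_map row_map_linear.

Lemma range_row_map : size us = c -> range row_map = span us.
Proof.
move=> sz_us; apply/seteqP; split=> [_ [v _ <-]|_ [a ->]].
  by move: v; rewrite /row_map -sz_us => v; exists (fun j => v 0 j).
move: a; rewrite /row_map sz_us => a; exists (\row_j a j) => //.
by apply: eq_bigr => j _; rewrite mxE.
Qed.

End RowMap.

(** * Free resolutions with uniformly bounded ranks *)

Section Syzygies.
Variables (R : comNzRingType) (xs : seq R) (l : nat).
Hypotheses (noethR : noetherian R)
  (radx : forall x a, x \in xs -> exists c, c * (1 - x * a) = 1)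
  (regR : regular_seq [set: R^o] [set 0] xs)
  (lenR : length_le (adjoin_seq [set: R^o] [set 0] xs) setT l).

(** The property inherited by syzygies, with [c] replaced by [c * l]. *)
Definition bounded_CM (M : lmodType R) (A : set M) (c : nat) : Prop :=
  [/\ exists us, span us = A, regular_seq A [set 0] xs &
      length_le (adjoin_seq A [set 0] xs) A c].

Lemma bounded_CM_cover (M : lmodType R) (A : set M) c : bounded_CM A c ->
  exists2 f : {linear 'rV[R]_c -> M}, range f = A &
    bounded_CM [set v | f v = 0] (c * l).
Proof.
move=> [[us0 span0] regA lenA].
have [us sz_us spanA] := length_le_generators radx span0 lenA.
pose f : {linear 'rV[R]_c -> M} := row_map us.
have rangef : range f = A by rewrite -spanA; apply: range_row_map.
exists f => //; have [|||regK lenK] := @kernel_length_le _ _ _ f xs (c * l)%N.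
- by rewrite -[[set 0]]entrywise0; apply: free_regular.
- by rewrite rangef.
- exact: free_length_le.
split=> //; apply: fg_noetherian noethR (free_finitely_generated R c) (submod_ker f).
Qed.

Lemma bounded_CM_resolution (M : lmodType R) c : bounded_CM [set: M] c ->
  let b i := iter i (muln^~ l) c in
  exists2 d : forall i, 'M[R]_(b i.+1, b i), forall i, d i.+1 *m d i = 0 &
  exists2 eps : {linear 'rV[R]_c -> M}, forall y, exists v, eps v = y &
    (forall v, eps v = 0 <-> exists w, v = w *m d 0%N) /\
    forall i (v : 'rV_(b i.+1)), v *m d i = 0 <-> exists w, v = w *m d i.+1.
Proof.
move=> /bounded_CM_cover[eps rangeE KE] b.
(* The index shifts: a syzygy inside the free module of rank [b i] is covered by the one of rank
   [b i.+1]. *)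
pose P i (A : set 'rV[R]_(b i)) := bounded_CM A (b i.+1).
pose S i := {A : set 'rV[R]_(b i) | P i A}.
have step i (s : S i) : {d : 'M[R]_(b i.+1, b i) & {s' : S i.+1 |
    (forall v, sval s v <-> exists w, v = w *m d) /\
    (forall v, sval s' v <-> v *m d = 0)}}.
  suff /cid[d /cid[s' sP]] : exists (d : 'M[R]_(b i.+1, b i)) (s' : S i.+1),
      (forall v, sval s v <-> exists w, v = w *m d) /\
      (forall v, sval s' v <-> v *m d = 0) by exists d, s'.
  case: s => A /= /bounded_CM_cover[f rangef Kf].
  exists (lin1_mx f), (exist (P i.+1) _ Kf); split=> v /=.
    rewrite -rangef; split=> [[w _ <-]|[w ->]]; last by exists w; rewrite ?mul_rV_lin1.
    by exists w; rewrite mul_rV_lin1.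
  by rewrite mul_rV_lin1.
(* The successive syzygies, starting with the kernel of [eps]; the rows of [d i] generate [s i], and
   [s i.+1] is the kernel of [d i]. *)
pose s := nat_rect S (exist (P 0%N) _ KE) (fun i si => sval (tagged (step i si))).
pose d i := tag (step i (s i)).
have dP i : (forall v, sval (s i) v <-> exists w, v = w *m d i) /\
    (forall v, sval (s i.+1) v <-> v *m d i = 0).
  by rewrite /d /s /=; case: (step i _) => di [].
have dK i (v : 'rV_(b i.+1)) : v *m d i = 0 <-> exists w, v = w *m d i.+1.
  exact: iff_trans (iff_sym ((dP i).2 v)) ((dP i.+1).1 v).
exists d.
  move=> i; apply/row_matrixP => j; rewrite row_mul row0.
  by apply/dK; exists (delta_mx 0 j); rewrite rowE.
exists eps.
  by move=> y; have [v _ eps_v] : range eps y; [rewrite rangeE | exists v].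
split=> // v; exact: (dP 0%N).1.
Qed.

End Syzygies.

(** * The algebra of all functions on a pointed set *)

Section FunctionAlgebra.
Variables (R : comNzRingType) (I : Type) (i0 : I).

(** The type carries a point of [I] as a parameter because 1 differs from 0 only when [I] is
    inhabited. *)
Definition function_algebra of I := I -> R.
Local Notation Z := (function_algebra i0).
Implicit Types f g h : Z.

HB.instance Definition _ := gen_eqMixin Z.
HB.instance Definition _ := gen_choiceMixin Z.

Let add f g : Z := fun i => f i + g i.
Let opp f : Z := fun i => - f i.
Let mul f g : Z := fun i => f i * g i.
Let scale (a : R) f : Z := fun i => a * f i.

Fact function_addA : associative add.
Proof. by move=> f g h; apply/funext => i; apply: addrA. Qed.
Fact function_addC : commutative add.
Proof. by move=> f g; apply/funext => i; apply: addrC. Qed.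
Fact function_add0 : left_id (fun=> 0 : R) add.
Proof. by move=> f; apply/funext => i; apply: add0r. Qed.
Fact function_addN : left_inverse (fun=> 0 : R) opp add.
Proof. by move=> f; apply/funext => i; apply: addNr. Qed.

HB.instance Definition _ := GRing.isZmodule.Build Z
  function_addA function_addC function_add0 function_addN.

Fact function_mulA : associative mul.
Proof. by move=> f g h; apply/funext => i; apply: mulrA. Qed.
Fact function_mulC : commutative mul.
Proof. by move=> f g; apply/funext => i; apply: mulrC. Qed.
Fact function_mul1 : left_id (fun=> 1 : R) mul.
Proof. by move=> f; apply/funext => i; apply: mul1r. Qed.
Fact function_mulD : left_distributive mul add.
Proof. by move=> f g h; apply/funext => i; apply: mulrDl. Qed.
Fact function_1neq0 : (fun=> 1 : R) != 0 :> Z.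
Proof. by apply/eqP => /(congr1 (fun f : Z => f i0)) /eqP; rewrite oner_eq0. Qed.

HB.instance Definition _ := GRing.Zmodule_isComNzRing.Build Z
  function_mulA function_mulC function_mul1 function_mulD function_1neq0.

Fact function_scaleA a b f : scale a (scale b f) = scale (a * b) f.
Proof. by apply/funext => i; apply: mulrA. Qed.
Fact function_scale1 : left_id 1 scale.
Proof. by move=> f; apply/funext => i; apply: mul1r. Qed.
Fact function_scaleDr : right_distributive scale +%R.
Proof. by move=> a f g; apply/funext => i; apply: mulrDr. Qed.
Fact function_scaleDl f : {morph scale^~ f : a b / a + b}.
Proof. by move=> a b; apply/funext => i; apply: mulrDl. Qed.

HB.instance Definition _ := GRing.Zmodule_isLmodule.Build R Z
  function_scaleA function_scale1 function_scaleDr function_scaleDl.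

Fact function_scaleAl (a : R) f g : a *: (f * g) = (a *: f) * g.
Proof. by apply/funext => i; apply: mulrA. Qed.

HB.instance Definition _ := GRing.Lmodule_isLalgebra.Build R Z function_scaleAl.
HB.instance Definition _ := GRing.Lalgebra_isComAlgebra.Build R Z.

Definition evaluation (i : I) (f : Z) : R^o := f i.

Fact evaluation_linear i : linear (evaluation i).
Proof. by []. Qed.
Fact evaluation_monoid i : monoid_morphism (evaluation i).
Proof. by []. Qed.

HB.instance Definition _ i :=
  GRing.isLinear.Build R Z R^o *:%R (evaluation i) (evaluation_linear i).
HB.instance Definition _ i :=
  GRing.isMonoidMorphism.Build Z R^o (evaluation i) (evaluation_monoid i).

End FunctionAlgebra.

Section TautologicalComplex.
Variables (R : comNzRingType) (b : nat -> nat).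

Definition differentials : Type :=
  {d : forall i, 'M[R]_(b i.+1, b i) | forall i, d i.+1 *m d i = 0}.

Definition zero_differentials : differentials :=
  exist (fun d : forall i, 'M[R]_(b i.+1, b i) => forall i, d i.+1 *m d i = 0)
    (fun=> 0) (fun=> mulmx0 _ _).

Definition universal_algebra : comAlgType R := function_algebra R zero_differentials.

(** Each entry is a coordinate function on the set of all complexes with ranks [b]. *)
Definition universal_differential i : 'M[universal_algebra]_(b i.+1, b i) :=
  \matrix_(j, k) ((fun d : differentials => sval d i j k) : universal_algebra).

Lemma map_universal_differential (d : differentials) i :
  map_mx (evaluation (i0 := zero_differentials) d) (universal_differential i) = sval d i.
Proof. by apply/matrixP => j k; rewrite !mxE. Qed.

(** Equality of functions is checked at each point [d], where evaluation turns the product into a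
    product of consecutive differentials of [d]. *)
Lemma universal_differentialK i :
  universal_differential i.+1 *m universal_differential i = 0.
Proof.
apply/matrixP => j k; rewrite mxE; apply/funext => d.
pose ev : {lrmorphism universal_algebra -> R^o} := evaluation (i0 := zero_differentials) d.
have := congr1 (fun A : 'M_(_, _) => A j k) (svalP d i).
rewrite -!map_universal_differential -(map_mxM ev) !mxE => evK.
exact: evK.
Qed.

Definition universal_complex : free_complex universal_algebra :=
  FreeComplex universal_differentialK.

End TautologicalComplex.

Unset Implicit Arguments.

Theorem corollary1p3 (R : comNzRingType) (m : set R)
    (hR : local_CM_ring m) (hb : bounded_multiplicity_type m) :
  exists (Z : comAlgType R) (F : free_complex Z),
    forall M : lmodType R, maximal_CM m M -> indecomposable M ->
      exists s : {lrmorphism Z -> R^o},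
        free_resolution (base_change s F) M.
Proof.
case: hR => noethR localR CMR; case: hb => B boundB.
have [_ [d dimR [[xs [sz_xs mxs /regular_sequence_seq[regR _]]] _]]] := CMR.
have [k k_gt0 nil] := parameters_nilpotent noethR localR dimR sz_xs mxs regR.
(* The constant depends on [R] and [xs] but not on [M]; it bounds the length of [M] modulo [xs]. *)
pose c := ((k * d.+1) ^ d * B)%N.
have bound (M : lmodType R) : maximal_CM m M -> indecomposable M ->
    bounded_CM xs [set: M] c.
  move=> CM_M indM; have [e eM le_eB] := boundB M CM_M indM; split.
  - by have [] := CM_M.
  - exact: (maximal_CM_regular noethR localR dimR CM_M sz_xs mxs nil).
  move=> n /(maximal_CM_length_le noethR localR dimR CM_M sz_xs mxs k_gt0 nil eM) le_n.
  by apply: leq_trans le_n _; rewrite leq_mul2l le_eB orbT.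
(* Being an indecomposable maximal Cohen-Macaulay module, [R] satisfies the same bound, so [c] also
   serves as the factor [l] for the ranks of syzygies. *)
have [_ _ lenR] := bound _ CMR (local_indecomposable noethR localR).
have radx x a : x \in xs -> exists c, c * (1 - x * a) = 1.
  by move=> /mxs; apply: max_radical.
pose b i := iter i (muln^~ c) c.
exists (universal_algebra R b), (universal_complex R b) => M CM_M indM.
have [D DK [eps epsS [epsK exD]]] :=
  bounded_CM_resolution noethR radx regR lenR (bound M CM_M indM).
(* The resolution of [M] is a point of the parameter set, and the section is evaluation there. *)
pose dD : differentials R b := exist _ D DK.
pose s : {lrmorphism universal_algebra R b -> R^o} :=
  evaluation (i0 := zero_differentials R b) dD.
have sE i : differential (base_change s (universal_complex R b)) i = D i.
  exact: (map_universal_differential dD i).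
exists s, eps; split=> // [v|i v]; first by rewrite sE.
by rewrite !sE; exact: exD.
Qed.
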